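(* The set of first- and second-order Poincaré-Chekanov polynomials for all possible augmentations of a DGA $(A,\partial)$ over $\mathbb{Z}/2$ is determined by the isomorphism class of its characteristic algebra $\mathcal{C}=A/I$ and the degree distribution of $A$. That is: if $(A,\partial)$ and $(A',\partial')$ are two DGAs over $\mathbb{Z}/2$, both graded over $\mathbb{Z}/(2r)$, with the same degree distribution and with isomorphic (as graded algebras) characteristic algebras, then for $n=1$ and $n=2$ the set of order-$n$ Poincaré-Chekanov polynomials $P_{\varepsilon,n}(\lambda)$, $\varepsilon$ ranging over all augmentations of $(A,\partial)$, equals the corresponding set for $(A',\partial')$.
   Context: A DGA over $\mathbb{Z}/2$ here (such as the mod 2 Chekanov-Eliashberg DGA of a Legendrian knot with rotation number $r$) is a free noncommutative unital algebra $A=(\mathbb{Z}/2)\langle a_1,\dots,a_n\rangle$ on finitely many generators, graded over $\mathbb{Z}/(2r)$ ($r\in\mathbb{Z}$) with each $a_i$ of pure degree, together with a map $\partial:A\to A$ that lowers degree by $1$, satisfies the Leibniz rule, $\partial(\mathbb{Z}/2)=0$, and $\partial^2=0$. The characteristic algebra is $\mathcal{C}=A/I$, where $I$ is the two-sided ideal generated by $\partial a_1,\dots,\partial a_n$, with grading induced from $A$. The degree distribution of $A$ is the map $\gamma:\mathbb{Z}/(2r)\to\mathbb{Z}_{\ge0}$, $i\mapsto\gamma_i$, where $\gamma_i$ is the number of generators of degree $i$. An augmentation is an algebra map $\varepsilon:A\to\mathbb{Z}/2$ with $\varepsilon(1)=1$, $\varepsilon\circ\partial=0$, and $\varepsilon$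 vanishing on every element of nonzero degree. Put $A_\varepsilon=\ker\varepsilon$; $\partial$ maps each power $(A_\varepsilon)^m$ into itself and so induces $\partial^{(n)}:A_\varepsilon/A_\varepsilon^{n+1}\to A_\varepsilon/A_\varepsilon^{n+1}$. Let $C_i^{(n)}$ be the degree-$i$ piece of $A_\varepsilon/A_\varepsilon^{n+1}$, $\alpha_i^{(n)}=\dim\ker(\partial^{(n)}:C_i^{(n)}\to C_{i-1}^{(n)})$ and $\beta_i^{(n)}=\dim\operatorname{im}(\partial^{(n)}:C_{i+1}^{(n)}\to C_i^{(n)})$. The Poincaré-Chekanov polynomial of order $n$ associated to $\varepsilon$ is $P_{\varepsilon,n}(\lambda)=\sum_{i\in\mathbb{Z}/(2r)}(\alpha_i^{(n)}-\beta_i^{(n)})\lambda^i$. *)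

(* Defs.v *)
From HB Require Import structures.
From mathcomp Require Import all_boot all_order all_algebra.
From mathcomp Require Import boolp classical_sets cardinality fsbigop.
From mathcomp Require Import finmap monalg.

Set Implicit Arguments.
Unset Strict Implicit.
Unset Printing Implicit Defensive.

Import GRing.Theory.
Local Open Scope classical_set_scope.
Local Open Scope ring_scope.
Local Open Scope quotient_scope.

(* MathComp's ring quotients only cover proper ideals of commutative rings.
   Below, A may be noncommutative and the ideal may be all of A, so that the
   quotient is in general only a [pzRingType]. *)
Section IdealQuotient.
Variables (K : fieldType) (A : lalgType K) (G : set A).

(* The two-sided ideal generated by G.  No scalar coefficients are needed:
   k *: (u * g * v) = (k *: u) * g * v. *)
Definition ideal_gen : {pred A} := fun x =>
  `[< exists2 s : seq (A * A * A),
        (forall t, t \in s -> G t.1.2) &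
        x = \sum_(t <- s) t.1.1 * t.1.2 * t.2 >].

Lemma ideal_genP x :
  reflect (exists2 s : seq (A * A * A), (forall t, t \in s -> G t.1.2) &
             x = \sum_(t <- s) t.1.1 * t.1.2 * t.2) (x \in ideal_gen).
Proof. exact: asboolP. Qed.

Lemma ideal_gen0 : 0 \in ideal_gen.
Proof. by apply/ideal_genP; exists [::] => //; rewrite big_nil. Qed.

Lemma ideal_genD x y :
  x \in ideal_gen -> y \in ideal_gen -> x + y \in ideal_gen.
Proof.
move=> /ideal_genP[s sG ->] /ideal_genP[t tG ->].
apply/ideal_genP; exists (s ++ t); last by rewrite big_cat.
by move=> u; rewrite mem_cat => /orP[/sG|/tG].
Qed.

Lemma ideal_genMl a x : x \in ideal_gen -> a * x \in ideal_gen.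
Proof.
move=> /ideal_genP[s sG ->]; apply/ideal_genP.
exists [seq (a * t.1.1, t.1.2, t.2) | t <- s].
  by move=> _ /mapP[t /sG Gt ->].
by rewrite big_map mulr_sumr; apply: eq_bigr => t _ /=; rewrite !mulrA.
Qed.

Lemma ideal_genMr a x : x \in ideal_gen -> x * a \in ideal_gen.
Proof.
move=> /ideal_genP[s sG ->]; apply/ideal_genP.
exists [seq (t.1.1, t.1.2, t.2 * a) | t <- s].
  by move=> _ /mapP[t /sG Gt ->].
by rewrite big_map mulr_suml; apply: eq_bigr => t _ /=; rewrite !mulrA.
Qed.

Lemma ideal_genZ (k : K) x : x \in ideal_gen -> k *: x \in ideal_gen.
Proof. by move=> xI; rewrite -[x]mul1r scalerAl ideal_genMl. Qed.

Lemma ideal_gen_zmod_closed : zmod_closed ideal_gen.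
Proof.
split=> [|x y xI yI]; first exact: ideal_gen0.
by rewrite ideal_genD // -mulN1r ideal_genMl.
Qed.

HB.instance Definition _ :=
  GRing.isZmodClosed.Build A ideal_gen ideal_gen_zmod_closed.

Lemma sub_ideal_gen x : G x -> x \in ideal_gen.
Proof.
move=> Gx; apply/ideal_genP; exists [:: (1, x, 1)].
  by move=> t; rewrite inE => /eqP ->.
by rewrite big_seq1 mul1r mulr1.
Qed.

Definition quot_alg : Type := {ideal_quot ideal_gen}.
HB.instance Definition _ := GRing.Zmodule.on quot_alg.

Definition proj (x : A) : quot_alg := \pi_{ideal_quot ideal_gen} x.

Lemma proj_eq x y : (proj x == proj y) = (x - y \in ideal_gen).
Proof. by rewrite /proj [RHS]Quotient.idealrBE. Qed.

Lemma proj_repr (q : quot_alg) : proj (repr q) = q.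
Proof. exact: reprK. Qed.

Lemma repr_proj x : repr (proj x) - x \in ideal_gen.
Proof. by rewrite -proj_eq proj_repr. Qed.

Lemma proj_zmod_morphism : zmod_morphism proj.
Proof. by move=> x y; rewrite /proj raddfB. Qed.

HB.instance Definition _ :=
  GRing.isZmodMorphism.Build A quot_alg proj proj_zmod_morphism.

Definition quot_scale (k : K) (p : quot_alg) : quot_alg :=
  proj (k *: repr p).

Lemma proj_scale k x : quot_scale k (proj x) = proj (k *: x).
Proof.
apply/eqP; rewrite proj_eq -scalerBr; exact/ideal_genZ/repr_proj.
Qed.

Fact quot_scalerA a b p : quot_scale a (quot_scale b p) = quot_scale (a * b) p.
Proof. by rewrite -[p]proj_repr !proj_scale scalerA. Qed.

Fact quot_scale1r : left_id 1 quot_scale.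
Proof. by move=> p; rewrite -[p]proj_repr proj_scale scale1r. Qed.

Fact quot_scalerDr : right_distributive quot_scale +%R.
Proof.
move=> k p q; rewrite -[p]proj_repr -[q]proj_repr -raddfD !proj_scale.
by rewrite scalerDr raddfD.
Qed.

Fact quot_scalerDl p : {morph quot_scale^~ p : a b / a + b}.
Proof.
by move=> a b; rewrite /= -[p]proj_repr !proj_scale scalerDl raddfD.
Qed.

HB.instance Definition _ := GRing.Zmodule_isLmodule.Build K quot_alg
  quot_scalerA quot_scale1r quot_scalerDr quot_scalerDl.

Definition quot_one : quot_alg := proj 1.
Definition quot_mul (p q : quot_alg) : quot_alg := proj (repr p * repr q).

Lemma proj_mul x y : quot_mul (proj x) (proj y) = proj (x * y).
Proof.
apply/eqP; rewrite proj_eq.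
have -> : repr (proj x) * repr (proj y) - x * y =
    (repr (proj x) - x) * repr (proj y) + x * (repr (proj y) - y).
  by rewrite mulrBl mulrBr addrA subrK.
by apply: ideal_genD; [apply: ideal_genMr | apply: ideal_genMl]; exact: repr_proj.
Qed.

Fact quot_mulA : associative quot_mul.
Proof.
by move=> p q s; rewrite -[p]proj_repr -[q]proj_repr -[s]proj_repr !proj_mul
  mulrA.
Qed.

Fact quot_mul1 : left_id quot_one quot_mul.
Proof. by move=> p; rewrite -[p]proj_repr proj_mul mul1r. Qed.

Fact quot_mulr1 : right_id quot_one quot_mul.
Proof. by move=> p; rewrite -[p]proj_repr proj_mul mulr1. Qed.

Fact quot_mulDl : left_distributive quot_mul +%R.
Proof.
move=> p q s; rewrite -[p]proj_repr -[q]proj_repr -[s]proj_repr -raddfD.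
by rewrite !proj_mul mulrDl raddfD.
Qed.

Fact quot_mulDr : right_distributive quot_mul +%R.
Proof.
move=> p q s; rewrite -[p]proj_repr -[q]proj_repr -[s]proj_repr -raddfD.
by rewrite !proj_mul mulrDr raddfD.
Qed.

HB.instance Definition _ := GRing.Zmodule_isPzRing.Build quot_alg
  quot_mulA quot_mul1 quot_mulr1 quot_mulDl quot_mulDr.

Fact proj_is_scalable : scalable proj.
Proof. by move=> k x; rewrite -proj_scale. Qed.

HB.instance Definition _ :=
  GRing.isScalable.Build K A quot_alg *:%R proj proj_is_scalable.

Fact proj_is_monoid_morphism : monoid_morphism proj.
Proof. by split=> // x y; rewrite -proj_mul. Qed.

HB.instance Definition _ :=
  GRing.isMonoidMorphism.Build A quot_alg proj proj_is_monoid_morphism.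

End IdealQuotient.

(* Dimension of a subspace S of an arbitrary vector space: the length d of a
   basis of S (and 0 if S has no finite basis, which does not happen below). *)
Definition basis_of_size (K : fieldType) (V : lmodType K) (S : set V) : set nat :=
  [set d | exists b : 'I_d -> V,
     (forall c : 'I_d -> K, \sum_i c i *: b i = 0 -> forall i, c i = 0) /\
     S = [set \sum_i c i *: b i | c in [set: 'I_d -> K]]].

Definition lin_dim (K : fieldType) (V : lmodType K) (S : set V) : nat :=
  xget 0%N (basis_of_size S).

Lemma basis_of_size_le (K : fieldType) (V : lmodType K) (S : set V) d e :
  basis_of_size S d -> basis_of_size S e -> (d <= e)%N.
Proof.
move=> [b [b_free Sb]] [c [_ Sc]].
have [M bM] : exists M : 'M[K]_(d, e), forall i, b i = \sum_j M i j *: c j.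
  have bS i : exists f : 'I_e -> K, \sum_j f j *: c j = b i.
    have [] : [set \sum_j f j *: c j | f in [set: 'I_e -> K]] (b i).
      rewrite -Sc Sb; exists (fun k => (k == i)%:R) => //.
      rewrite (bigD1 i) //= eqxx scale1r big1 ?addr0 // => k /negPf ->.
      by rewrite scale0r.
    by move=> f _ fb; exists f.
  have [F FE] := choice bS.
  by exists (\matrix_(i, j) F i j) => i; rewrite -FE;
    apply: eq_bigr => j _; rewrite mxE.
rewrite leqNgt; apply/negP => lt_ed.
have : kermx M != 0.
  by rewrite kermx_eq0 /row_free neq_ltn (leq_ltn_trans (rank_leq_col M) lt_ed).
case/eqP; apply/matrixP => i k; rewrite [RHS]mxE.
apply: (b_free (fun k => kermx M i k)).
under eq_bigr do rewrite bM scaler_sumr.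
rewrite exchange_big big1 //= => j _.
under eq_bigr do rewrite scalerA.
rewrite -scaler_suml.
have /matrixP/(_ i j) := mulmx_ker M.
by rewrite !mxE => ->; rewrite scale0r.
Qed.

Lemma lin_dimE (K : fieldType) (V : lmodType K) (S : set V) d :
  basis_of_size S d -> lin_dim S = d.
Proof.
move=> Sd; have Sx := xgetPex 0%N (ex_intro _ d Sd).
by apply/eqP; rewrite eqn_leq !(basis_of_size_le Sx Sd, basis_of_size_le Sd Sx).
Qed.

Lemma lin_dim_set0 (K : fieldType) (V : lmodType K) (S : set V) :
  S = [set 0] -> lin_dim S = 0%N.
Proof.
move=> ->; apply: lin_dimE; exists (fun=> 0); split=> [c _ []//|].
apply/seteqP; split=> [x ->|x [c _ <-]]; last by rewrite big_ord0.
by exists (fun=> 0) => //; rewrite big_ord0.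
Qed.

Section Degrees.
Variable r : int.

(* The group Z/(2r); for r = 0 this is Z. *)
Definition degree : Type := {ideal_quot (dvdz (2 * r) : {pred int})}.
HB.instance Definition _ := GRing.Zmodule.on degree.

Definition degree_of_int (k : int) : degree :=
  \pi_{ideal_quot (dvdz (2 * r) : {pred int})} k.

End Degrees.

(* The free unital algebra F_2<a_0, ..., a_(n-1)>: the monoid algebra over the
   free monoid of words in 'I_n. *)
Notation free_algebra n := {malg 'F_2[{fmonom 'I_n}]}.

Definition gen n (j : 'I_n) : free_algebra n := << fmu j >>.

Section Grading.
Variables (r : int) (n : nat) (gdeg : 'I_n -> degree r).

Definition word_degree (w : {fmonom 'I_n}) : degree r :=
  \sum_(j <- (w : seq 'I_n)) gdeg j.

Definition homogeneous (i : degree r) : set (free_algebra n) :=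
  [set x | forall w, w \in msupp x -> word_degree w = i].

Lemma homogeneous_gen (j : 'I_n) : homogeneous (gdeg j) (gen j).
Proof.
move=> w; rewrite msuppU1 inE => /eqP ->.
by rewrite /word_degree fmU big_seq1.
Qed.

End Grading.

Lemma word_gen n (w : {fmonom 'I_n}) :
  << w >> = \prod_(j <- (w : seq 'I_n)) gen j :> free_algebra n.
Proof.
case: w => s /=; elim: s => [|j s IHs]; first by rewrite big_nil -fmoneE.
rewrite big_cons -IHs /gen malgM_def fgmulUU mulr1; congr (<< _ *g _ >>).
by apply/eqP; rewrite fmP fmM fmU.
Qed.

Record dga (r : int) := DGA {
  ngen : nat;
  gdeg : 'I_ngen -> degree r;
  diff : {linear free_algebra ngen -> free_algebra ngen};
  diff_degree : forall (i : degree r) (x : free_algebra ngen),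
    homogeneous gdeg i x ->
    homogeneous gdeg (i - degree_of_int r 1) (diff x);
  diff_Leibniz : forall x y : free_algebra ngen,
    diff (x * y) = diff x * y + x * diff y;
  diff_const : forall c : 'F_2, diff c%:A = 0;
  diff_diff : forall x : free_algebra ngen, diff (diff x) = 0
}.

Section DGA.
Variables (r : int) (D : dga r).
Local Notation A := (free_algebra (ngen D)).

Definition degree_distribution (i : degree r) : nat :=
  #|[pred j : 'I_(ngen D) | gdeg j == i]|.

Definition char_algebra :=
  quot_alg [set diff D (gen j) | j in [set: 'I_(ngen D)]].

Definition char_piece (i : degree r) : set char_algebra :=
  [set proj _ x | x in homogeneous (@gdeg r D) i].

Record augmentation := Augmentation {
  aug :> {lrmorphism A -> 'F_2 | *%R};
  aug_diff : forall x, aug (diff D x) = 0;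
  aug_degree : forall (i : degree r) (x : A),
    i != 0 -> homogeneous (@gdeg r D) i x -> aug x = 0
}.

Section Linearized.
Variables (eps : augmentation) (n : nat).

(* A_eps *)
Definition aug_ideal : set A := [set x | eps x = 0].

(* The m-fold products that generate the ideal (A_eps)^m *)
Definition aug_products (m : nat) : set A :=
  [set \prod_(k < m) y k | y in [set y : 'I_m -> A | forall k, aug_ideal (y k)]].

(* A / A_eps^(n+1); the space A_eps / A_eps^(n+1) is the image of A_eps in it. *)
Definition trunc_algebra := quot_alg (aug_products n.+1).

Definition trunc_diff (q : trunc_algebra) : trunc_algebra :=
  proj _ (diff D (repr q)).

Lemma aug_products_cons m a x : aug_ideal a ->
  x \in ideal_gen (aug_products m) -> a * x \in ideal_gen (aug_products m.+1).
Proof.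
move=> aA /ideal_genP[s sG ->]; rewrite mulr_sumr big_seq.
apply: rpred_sum => t /sG [y yA /= <-].
rewrite !mulrA; apply: ideal_genMr; apply: sub_ideal_gen.
exists (fun k => if unlift ord0 k is Some k' then y k' else a * t.1.1).
  move=> k; case: unliftP => [k' _|_]; first exact: yA.
  by rewrite /aug_ideal /= rmorphM; apply: etrans (congr1 ( *%R^~ _) aA) (mul0r _).
rewrite big_ord_recl unlift_none; congr (_ * _).
by apply: eq_bigr => k _; rewrite liftK.
Qed.

Lemma aug_products_diff m x :
  x \in ideal_gen (aug_products m) -> diff D x \in ideal_gen (aug_products m).
Proof.
have prodJ p (y : 'I_p -> A) : (forall k, aug_ideal (y k)) ->
    \prod_(k < p) y k \in ideal_gen (aug_products p).
  by move=> yA; apply: sub_ideal_gen; exists y.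
have diff_prodJ p (y : 'I_p -> A) : (forall k, aug_ideal (y k)) ->
    diff D (\prod_(k < p) y k) \in ideal_gen (aug_products p).
  elim: p y => [|p IHp] y yA.
    rewrite big_ord0 -[1 : A](scale1r (1 : A)) diff_const; exact: rpred0.
  rewrite big_ord_recl diff_Leibniz; apply: rpredD.
    apply: aug_products_cons; first exact: aug_diff.
    by apply: prodJ => k; exact: yA.
  by apply: aug_products_cons; [exact: yA | apply: IHp => k; exact: yA].
move=> /ideal_genP[s sG ->]; rewrite raddf_sum big_seq.
apply: rpred_sum => t /sG [y yA /= <-].
rewrite !diff_Leibniz; apply: rpredD; last first.
  by apply: ideal_genMr; apply: ideal_genMl; exact: prodJ.
apply: ideal_genMr; apply: rpredD.
  by apply: ideal_genMl; exact: prodJ.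
by apply: ideal_genMl; exact: diff_prodJ.
Qed.

Lemma trunc_diff_proj x : trunc_diff (proj _ x) = proj _ (diff D x).
Proof.
apply/eqP; rewrite proj_eq -raddfB; apply: aug_products_diff.
exact: repr_proj.
Qed.

(* C_i^(n) *)
Definition trunc_piece (i : degree r) : set trunc_algebra :=
  [set proj _ x | x in aug_ideal `&` homogeneous (@gdeg r D) i].

Definition alpha (i : degree r) : nat :=
  lin_dim [set q | trunc_piece i q /\ trunc_diff q = 0].

Definition beta (i : degree r) : nat :=
  lin_dim [set trunc_diff q | q in trunc_piece (i + degree_of_int r 1)].

Definition low_degrees : set (degree r) :=
  [set i | exists2 u : seq 'I_(ngen D), (size u <= n)%N &
           \sum_(j <- u) gdeg j = i].

Lemma finite_low_degrees : finite_set low_degrees.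
Proof.
pose T := {m : 'I_n.+1 & m.-tuple 'I_(ngen D)}.
apply: (@sub_finite_set _ _
  [set \sum_(j <- (tagged t : seq _)) gdeg j | t in [set: T]]).
  move=> i [u un <-]; have un' : (size u < n.+1)%N by [].
  by exists (existT (fun m : 'I_n.+1 => m.-tuple 'I_(ngen D)) (Ordinal un')
    (in_tuple u)).
exact/finite_image/finite_finset.
Qed.

Let shift (j : 'I_(ngen D)) : A := gen j - (eps (gen j))%:A.

Lemma shift_aug j : aug_ideal (shift j).
Proof. by rewrite /aug_ideal /shift /= linearB linearZ /= rmorph1 mulr1 subrr. Qed.

Lemma prod_shift_gen (v w : seq 'I_(ngen D)) :
  ~ low_degrees (\sum_(j <- v ++ w) gdeg j) ->
  \prod_(j <- v) shift j * \prod_(j <- w) gen j \in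
    ideal_gen (aug_products n.+1).
Proof.
elim: w v => [|j w IHw] v.
  rewrite cats0 big_nil mulr1 => vN.
  have {vN} : (n < size v)%N.
    by rewrite ltnNge; apply/negP => vn; apply: vN; exists v.
  elim: v n => // j v IHv [|m] mv; rewrite big_cons.
    apply: ideal_genMr; apply: sub_ideal_gen; exists (fun=> shift j).
      by move=> _; exact: shift_aug.
    by rewrite big_ord1.
  by apply: aug_products_cons; [exact: shift_aug | exact: IHv].
move=> vwN; rewrite big_cons.
have -> : gen j = shift j + (eps (gen j))%:A by rewrite subrK.
rewrite mulrDl mulrDr mulrA; apply: rpredD.
  have -> : \prod_(j <- v) shift j * shift j = \prod_(j <- rcons v j) shift j.
    by rewrite big_rcons.
  by apply: IHw; rewrite cat_rcons.
rewrite -scalerAl mul1r; have [->|ej] := eqVneq (eps (gen j)) 0.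
  by rewrite scale0r mulr0; exact: rpred0.
have j0 : gdeg j = 0.
  apply/eqP; apply: contraT => jN0; case/eqP: ej.
  by apply: aug_degree jN0 _; exact: homogeneous_gen.
have -> : eps (gen j) = 1.
  by move: ej; case: (eps (gen j)) => -[|[|//]] k // _; exact: val_inj.
rewrite scale1r; apply: IHw.
by move: vwN; rewrite !big_cat big_cons j0 /= add0r.
Qed.

Lemma trunc_piece_eq0 i : ~ low_degrees i -> trunc_piece i = [set 0].
Proof.
move=> iN; apply/seteqP; split=> [_ [x [_ xi] <-]|_ ->]; last first.
  exists 0; last exact: raddf0.
  by split=> [|w]; [exact: raddf0 | rewrite msupp0 inE].
apply/eqP; rewrite -(raddf0 (@proj _ _ (aug_products n.+1))) proj_eq subr0.
rewrite [x]monalgE big_seq; apply: rpred_sum => w /xi wi.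
have -> : << x@_w *g w >> = x@_w *: << w >> :> A.
  by apply/malgP => k; rewrite mcoeffZ !mcoeffU mulr_natr.
apply: ideal_genZ.
have := @prod_shift_gen [::] w; rewrite big_nil mul1r -word_gen; apply.
by move: wi; rewrite /word_degree /= => ->.
Qed.

Lemma finite_poincare_support :
  finite_set [set i | (alpha i)%:Z - (beta i)%:Z != 0].
Proof.
have fD := finite_low_degrees.
pose D1 := [set i - degree_of_int r 1 | i in low_degrees].
apply: (@sub_finite_set _ _ (low_degrees `|` D1)); last first.
  by rewrite finite_setU; split=> //; exact: finite_image.
move=> i /= abN; apply: contrapT => /not_orP[iN i1N]; case/eqP: abN.
rewrite /alpha /beta (lin_dim_set0 (S := [set q | _])); last first.
  rewrite (trunc_piece_eq0 iN); apply/seteqP; split=> [q []//|_ ->].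
  by split=> //; rewrite -[X in trunc_diff X](raddf0 (@proj _ _ _))
    trunc_diff_proj !raddf0.
rewrite lin_dim_set0 ?subrr// trunc_piece_eq0; last first.
  by move=> iD; apply: i1N; exists (i + degree_of_int r 1); rewrite ?addrK.
rewrite image_set1 -[X in trunc_diff X](raddf0 (@proj _ _ _)).
by rewrite trunc_diff_proj !raddf0.
Qed.

(* An integer combination of formal monomials lambda^i, i in Z/(2r). *)
Definition poincare_chekanov : {malg int[degree r]} :=
  \sum_(i \in [set: degree r]) << (alpha i)%:Z - (beta i)%:Z *g i >>.

End Linearized.

End DGA.

Definition graded_algebra_isomorphic (r : int) (D D' : dga r) : Prop :=
  exists f : {rmorphism char_algebra D -> char_algebra D'},
    [/\ scalable f, bijective f &
        forall i : degree r, f @` @char_piece r D i = @char_piece r D' i].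

(* Main.v *)
Require Import Defs.
From HB Require Import structures.
From mathcomp Require Import fingroup perm.
From mathcomp Require Import all_boot all_order all_algebra.
From mathcomp Require Import boolp classical_sets fsbigop.
From mathcomp Require Import finmap monalg.

Set Implicit Arguments.
Unset Strict Implicit.
Unset Printing Implicit Defensive.

Import GRing.Theory.
Local Open Scope classical_set_scope.
Local Open Scope ring_scope.

(** Fix an augmentation eps of A with kernel M, and let I be the characteristic
    ideal, so that the characteristic algebra is A / I.  As eps kills I, it is
    the same thing as an augmentation of A / I; an isomorphism f between the
    characteristic algebras of A and A' therefore matches the augmentations of A
    with those of A', and it remains to compare the polynomials of eps and eps'.

    Rank-nullity in M / M^(n+1) gives
      alpha_i - beta_i = dim C_i - beta_(i-1) - beta_i,
    so everything reduces to dim C_i and to the ranks beta_i.  For n <= 2 these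
    ranks can be read off from the ideal I alone.  Write J_i for the degree i
    part of I modulo M^(n+1), and K_i for that of I^2.  The differential maps J
    onto K, and the kernel of this map is exactly the space of boundaries:
      dim J_i = beta_i + dim K_(i-1)                             [dim_J].
    That d(I) lies in I^2 is the Leibniz rule, and every product pq of elements
    of I is, modulo M^3, of the form (dz)(dw) = d(z dw).  That an element of I
    killed by d modulo M^3 is a boundary is a Kunneth phenomenon: with
    V = M / M^2, with d_1 the differential of V and B its image, it says that a
    d-closed element of B (x) V + V (x) B, inside V (x) V = M^2 / M^3, is a
    boundary.  A linear map h with d_1 h d_1 = d_1 yields an explicit
    contracting homotopy [homotopy_matrix].

    The three dimensions that remain, of C_i, J_i and K_i, are compared by
    lifting f to a degree-preserving algebra map phi : A -> A'
    [exists_lift].  Any choice of homogeneous lifts of the f(a_j) maps I into I',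
    I^2 into I'^2 and M into M'; what is needed is a choice for which phi is
    injective on M / M^(n+1).  Injectivity is detected by the linear part
    V -> V' of phi [phi_augpow_inj].  The lifts may be changed by elements of I',
    which adds to the matrix of the linear part an arbitrary combination of
    linear parts of boundaries.  Since f is onto, the rows of the matrix and of
    d_1 together span V', and since the degree distributions agree the matrix is
    square in each degree.  A field has stable rank one: under these two
    conditions such a combination can make the matrix invertible
    [stable_range].  So the dimensions for A are at most those for A', and
    exchanging A and A' gives equality.

    The powers of M are handled with Fox derivatives: every x can be written
    uniquely as eps(x) + sum_j x_j D_j(x) in the shifted generators
    x_j = a_j + eps(a_j), and x lies in M^(m+1) if and only if eps(x) = 0 and
    all D_j(x) lie in M^m [augpowS]. *)

(** * Dimensions of subspaces *)

Section Dimension.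
Variable K : fieldType.

Definition submod (V : lmodType K) (S : set V) :=
  S 0 /\ forall (c : K) x y, S x -> S y -> S (c *: x + y).

Definition fin_spanned (V : lmodType K) (S : set V) :=
  exists d (v : 'I_d -> V),
    forall x, S x -> exists c : 'I_d -> K, x = \sum_i c i *: v i.

Definition free_family (V : lmodType K) d (b : 'I_d -> V) :=
  forall c : 'I_d -> K, \sum_i c i *: b i = 0 -> forall i, c i = 0.

Lemma submod_sum (V : lmodType K) (S : set V) (I : Type) (s : seq I)
    (c : I -> K) (v : I -> V) :
  submod S -> (forall i, S (v i)) -> S (\sum_(i <- s) c i *: v i).
Proof.
move=> [S0 SD] Sv; elim: s => [|i s IHs]; first by rewrite big_nil.
by rewrite big_cons; apply: SD.
Qed.

(** Steinitz: a coordinate matrix with more rows than columns has a nonzero left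
    kernel. *)
Lemma free_family_le (V : lmodType K) d e (b : 'I_d -> V) (v : 'I_e -> V) :
  free_family b -> (forall i, exists c : 'I_e -> K, b i = \sum_j c j *: v j) ->
  (d <= e)%N.
Proof.
move=> b_free /choice[F bF]; pose M := \matrix_(i, j) F i j.
rewrite leqNgt; apply/negP => lt_ed.
have : kermx M != 0.
  by rewrite kermx_eq0 /row_free neq_ltn (leq_ltn_trans (rank_leq_col M) lt_ed).
case/eqP; apply/matrixP => i k; rewrite [RHS]mxE.
apply: (b_free (fun k => kermx M i k)).
under eq_bigr do rewrite bF scaler_sumr.
rewrite exchange_big big1 //= => j _.
under eq_bigr do rewrite scalerA.
rewrite -scaler_suml.
have /matrixP/(_ i j) := mulmx_ker M; rewrite !mxE => kj.
by under eq_bigr do [rewrite -[F _ j](mxE matrix_key (fun i j => F i j))];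
  rewrite kj scale0r.
Qed.

(** A free family of maximal size in S spans S: its size is bounded, and adding a
    vector outside of its span would keep it free. *)
Lemma basis_exists (V : lmodType K) (S : set V) :
  submod S -> fin_spanned S -> exists d, basis_of_size S d.
Proof.
move=> Ssub [e [v Sv]].
pose P d := `[< exists b : 'I_d -> V, free_family b /\ forall i, S (b i) >].
have P0 : exists d, P d.
  by exists 0%N; apply/asboolP; exists (fun=> 0); split=> [c _ []|[]].
have Ple d : P d -> (d <= e)%N.
  move=> /asboolP[b [bfree bS]].
  by apply: (@free_family_le _ _ _ b v) => // i; apply: Sv.
case: (ex_maxnP P0 Ple) => d /asboolP[b [bfree bS]] dmax.
exists d, b; split=> //; apply/seteqP; split=> [x Sx|_ [c _ <-]]; last first.
  exact: submod_sum.
apply: contrapT => xN.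
suff /dmax : P d.+1 by rewrite ltnn.
apply/asboolP.
exists (fun i => if unlift ord0 i is Some j then b j else x); split; last first.
  by move=> i; case: unliftP.
move=> c; rewrite big_ord_recl unlift_none => cx.
have {}cx : c ord0 *: x + \sum_i c (lift ord0 i) *: b i = 0.
  by rewrite -[RHS]cx; congr (_ + _); apply: eq_bigr => i _; rewrite liftK.
have [c0|c0] := eqVneq (c ord0) 0.
  have cb i : c (lift ord0 i) = 0.
    by apply: (bfree (fun i => c (lift ord0 i))); rewrite -[RHS]cx c0 scale0r add0r.
  by move=> i; case: (unliftP ord0 i) => [j|] ->.
case: xN; exists (fun i => - (c ord0)^-1 * c (lift ord0 i)) => //.
under eq_bigr do rewrite -scalerA.
rewrite -scaler_sumr; move/eqP: cx; rewrite addrC addr_eq0 => /eqP ->.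
by rewrite scaleNr scalerN opprK scalerA mulVf ?scale1r.
Qed.

Lemma sub_fin_spanned (V : lmodType K) (S S' : set V) :
  S `<=` S' -> fin_spanned S' -> fin_spanned S.
Proof. by move=> SS [d [v Sv]]; exists d, v => x /SS/Sv. Qed.

Lemma fin_spanned_basis (V : lmodType K) (S : set V) :
  submod S -> fin_spanned S -> basis_of_size S (lin_dim S).
Proof. by move=> Ssub /(basis_exists Ssub)[d Sd]; rewrite (lin_dimE Sd). Qed.

Section Image.
Variables (V W : lmodType K) (g : {linear V -> W}).

Lemma submod_image (S : set V) : submod S -> submod (g @` S).
Proof.
move=> [S0 SD]; split; first by exists 0; rewrite ?linear0.
by move=> c _ _ [x Sx <-] [y Sy <-]; exists (c *: x + y); rewrite ?linearP//; exact: SD.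
Qed.

Lemma fin_spanned_image (S : set V) : fin_spanned S -> fin_spanned (g @` S).
Proof.
move=> [d [v Sv]]; exists d, (g \o v) => _ [x /Sv[c ->] <-]; exists c.
by rewrite linear_sum; apply: eq_bigr => i _; rewrite linearZ.
Qed.

Lemma rank_nullity (S : set V) : submod S -> fin_spanned S ->
  lin_dim S = (lin_dim [set x | S x /\ g x = 0%R] + lin_dim (g @` S))%N.
Proof.
move=> Ssub Sfin; pose N := [set x | S x /\ g x = 0].
have Nsub : submod N.
  have [S0 SD] := Ssub; split; first by split=> //; rewrite linear0.
  move=> c x y [Sx gx] [Sy gy]; split; first exact: SD.
  by rewrite linearP gx gy scaler0 addr0.
have NS : N `<=` S by move=> x [].
have := fin_spanned_basis Nsub (sub_fin_spanned NS Sfin).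
have := fin_spanned_basis (submod_image Ssub) (fin_spanned_image Sfin).
move: (lin_dim (g @` S)) (lin_dim N) => m n [b [b_free gSb]] [a [a_free Na]].
have aN i : N (a i).
  rewrite Na; exists (fun k => (k == i)%:R) => //.
  by rewrite (bigD1 i) //= eqxx scale1r big1 ?addr0 // => k /negPf ->; rewrite scale0r.
have /choice[s sP] : forall i, exists x, S x /\ g x = b i.
  move=> i; have [x Sx gx] : (g @` S) (b i).
    rewrite gSb; exists (fun k => (k == i)%:R) => //.
    by rewrite (bigD1 i) //= eqxx scale1r big1 ?addr0 // => k /negPf ->; rewrite scale0r.
  by exists x.
apply: lin_dimE.
exists (fun k => match split k with inl i => a i | inr i => s i end).
have sumE (c : 'I_(n + m) -> K) :
    \sum_k c k *: match split k with inl i => a i | inr i => s i end =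
    \sum_i c (lshift _ i) *: a i + \sum_i c (rshift _ i) *: s i.
  by rewrite big_split_ord; congr (_ + _); apply: eq_bigr => i _;
    rewrite (unsplitK (inl i), unsplitK (inr i)).
have gsum c : g (\sum_i c i *: s i) = \sum_i c i *: b i.
  by rewrite linear_sum; apply: eq_bigr => i _; rewrite linearZ /= (sP i).2.
have asum c : g (\sum_i c i *: a i) = 0.
  by rewrite linear_sum big1 // => i _; rewrite linearZ /= (aN i).2 scaler0.
split=> [c|].
  rewrite sumE => c0.
  have cr i : c (rshift _ i) = 0.
    apply: (b_free (fun i => c (rshift _ i))).
    by rewrite -gsum -[LHS]add0r -(asum (fun i => c (lshift m i))) -linearD c0 linear0.
  have cl i : c (lshift _ i) = 0.
    apply: (a_free (fun i => c (lshift _ i))).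
    by rewrite -[RHS]c0 [X in _ + X]big1 ?addr0// => j _; rewrite cr scale0r.
  by move=> k; rewrite -[k]splitK; case: (split k) => j /=.
apply/seteqP; split=> [x Sx|_ [c _ <-]]; last first.
  rewrite sumE -[X in X + _](scale1r (\sum_i c (lshift _ i) *: a i)).
  apply: (Ssub.2); first by apply: submod_sum => // i; exact: (aN i).1.
  by apply: submod_sum => // i; exact: (sP i).1.
have [c _ gx] : [set \sum_i c i *: b i | c in [set: 'I_m -> K]] (g x).
  by rewrite -gSb; exists x.
have [c' _ cx] : [set \sum_i c i *: a i | c in [set: 'I_n -> K]]
    (x - \sum_i c i *: s i).
  rewrite -Na; split; last by rewrite linearB /= gsum -gx subrr.
  rewrite addrC -scaleN1r; apply: (Ssub.2) => //.
  by apply: submod_sum => // i; exact: (sP i).1.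
exists (fun k => match split k with inl i => c' i | inr i => c i end) => //.
rewrite sumE -[RHS](subrK (\sum_i c i *: s i)) -cx.
by congr (_ + _); apply: eq_bigr => i _; rewrite (unsplitK (inl i), unsplitK (inr i)).
Qed.

End Image.

(** The form in which dimensions of subquotients are compared: phi need not descend
    to a map from V to V', it only has to be injective modulo the kernels of p
    and p' on the subspace considered. *)
Lemma lin_dim_image_le (A A' V V' : lmodType K) (p : {linear A -> V})
    (p' : {linear A' -> V'}) (phi : {linear A -> A'}) (X : set A) (X' : set A') :
  submod X -> submod X' -> fin_spanned (p @` X) -> fin_spanned (p' @` X') ->
  (forall x, X x -> X' (phi x)) ->
  (forall x, X x -> p' (phi x) = 0 -> p x = 0) ->
  (lin_dim (p @` X) <= lin_dim (p' @` X'))%N.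
Proof.
move=> Xsub X'sub pX p'X phiX inj.
have [b [b_free Xb]] := fin_spanned_basis (submod_image p Xsub) pX.
have [b' [_ Xb']] := fin_spanned_basis (submod_image p' X'sub) p'X.
have /choice[s sP] : forall i, exists x, X x /\ p x = b i.
  move=> i; have [x Sx gx] : (p @` X) (b i).
    rewrite Xb; exists (fun k => (k == i)%:R) => //.
    by rewrite (bigD1 i) //= eqxx scale1r big1 ?addr0 // => k /negPf ->; rewrite scale0r.
  by exists x.
apply: (@free_family_le _ _ _ (fun i => p' (phi (s i))) b') => [c c0|i].
  apply: b_free.
  have {}c0 : p' (phi (\sum_i c i *: s i)) = 0.
    by rewrite -[RHS]c0 !linear_sum; apply: eq_bigr => i _; rewrite !linearZ.
  rewrite -[RHS](inj _ _ c0); last by apply: submod_sum => // i; exact: (sP i).1.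
  by rewrite linear_sum; apply: eq_bigr => i _; rewrite linearZ /= (sP i).2.
have [c _ cE] : [set \sum_j c j *: b' j | c in [set: 'I_(lin_dim (p' @` X')) -> K]]
    (p' (phi (s i))).
  by rewrite -Xb'; exists (phi (s i)) => //; apply: phiX; exact: (sP i).1.
by exists c.
Qed.

End Dimension.

(** * Stable rank one *)

Section StableRange.
Variable K : fieldType.

(** After Gaussian elimination G is a partial identity q, and the rows of T are
    only needed to fill the complementary coordinates c = 1 - q.  The combination
    of T whose part in these coordinates is c turns q into 1 + N with N = c N q,
    and N^2 = 0 because q c = 0. *)
Lemma stable_range n p (G : 'M[K]_n) (T : 'M_(p, n)) A B :
  A *m G + B *m T = 1%:M -> exists E, G + E *m T \in unitmx.
Proof.
move=> AGBT; pose L := col_ebase G; pose U := row_ebase G.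
pose c : 'M[K]_n := copid_mx (\rank G); pose q : 'M[K]_n := pid_mx (\rank G).
have cq : c *m q = 0 by apply: mul_copid_mx_pid; exact: rank_leq_row.
have qc : q *m c = 0 by apply: mul_pid_mx_copid; exact: rank_leq_row.
have cqD : q + c = 1%:M by rewrite addrC subrK.
have Lu : L \in unitmx by exact: col_ebase_unit.
have Uu : U \in unitmx by exact: row_ebase_unit.
have GE : G = L *m q *m U by rewrite mulmx_ebase.
clearbody c q L U.
have cc : c *m c = c by rewrite -[RHS]mulmx1 -cqD mulmxDr cq add0r.
pose D := c *m (U *m B); pose T1 := T *m invmx U.
have DTc : D *m T1 *m c = c.
  have : U *m (A *m G + B *m T) *m invmx U = 1%:M.
    by rewrite AGBT mulmx1 mulmxV.
  rewrite mulmxDr mulmxDl {1}GE !mulmxA mulmxK // => /(congr1 (fun X => c *m X *m c)).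
  rewrite mulmxDr mulmxDl mulmx1 cc !mulmxA -[_ *m q *m c]mulmxA qc mulmx0 add0r.
  by rewrite /D /T1 !mulmxA.
pose N := D *m T1 *m q.
have NN : N *m N = 0.
  by rewrite /N /D -!mulmxA [q *m (c *m _)]mulmxA qc mul0mx !mulmx0.
exists (L *m D).
have -> : G + L *m D *m T = L *m (1%:M + N) *m U.
  rewrite -cqD -[X in q + X]DTc -addrA -mulmxDr [c + q]addrC cqD mulmx1.
  by rewrite mulmxDr mulmxDl -GE /T1 -!mulmxA mulVmx // mulmx1.
rewrite !unitmx_mul Lu Uu andbT.
suff /mulmx1_unit[] : (1%:M + N) *m (1%:M - N) = 1%:M by [].
by rewrite mulmxBr mulmx1 mulmxDl mul1mx NN addr0 addrK.
Qed.

Section Graded.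
Variable deg : eqType.

(** The matrices are block diagonal for the degree, so [stable_range] is applied to
    each block; to keep the size fixed, the block of degree i is completed by the
    identity in the other degrees. *)
Lemma graded_stable_range_square n p (d : 'I_n -> deg) (e : 'I_p -> deg)
    (G : 'M[K]_n) (T : 'M_(p, n)) A B :
  (forall j k, d j != d k -> G j k = 0) ->
  (forall l k, e l != d k -> T l k = 0) ->
  A *m G + B *m T = 1%:M ->
  exists2 E : 'M_(n, p), (forall j l, d j != e l -> E j l = 0) &
    row_free (G + E *m T).
Proof.
move=> Gd Td AGBT.
pose Gi i : 'M[K]_n := \matrix_(j, k)
  if (d j == i) && (d k == i) then G j k else (j == k)%:R.
pose Ti i : 'M[K]_(p, n) := \matrix_(l, k) if d k == i then T l k else 0.
have /choice[E0 E0P] i : exists E, Gi i + E *m Ti i \in unitmx.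
  pose Ai : 'M[K]_n := \matrix_(k, j)
    if d k == i then if d j == i then A k j else 0 else (k == j)%:R.
  pose Bi : 'M[K]_(n, p) := \matrix_(k, l) if d k == i then B k l else 0.
  apply: (@stable_range _ _ _ _ Ai Bi).
  apply/matrixP => k m; rewrite !mxE.
  have [ki|ki] := eqVneq (d k) i; last first.
    rewrite (bigD1 k) //= !mxE (negPf ki) eqxx mul1r big1 => [|j jk]; last first.
      by rewrite !mxE (negPf ki) eq_sym (negPf jk) mul0r.
    rewrite addr0 big1 ?addr0// => l _.
    by rewrite !mxE (negPf ki) mul0r.
  have [mi|mi] := eqVneq (d m) i.
    move/matrixP/(_ k m): AGBT; rewrite !mxE => <-; congr (_ + _); apply: eq_bigr.
      move=> j _; rewrite !mxE ki mi eqxx andbT; case: eqVneq => [//|ji].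
      by rewrite Gd ?mulr0 ?mul0r// mi.
    by move=> l _; rewrite !mxE ki mi eqxx.
  have -> : (k == m) = false by apply: contra_neqF mi => /eqP <-.
  rewrite !big1 ?addr0// => j _; rewrite !mxE ki eqxx (negPf mi) ?mulr0//.
  rewrite andbF; case: (eqVneq (d j) i) => [ji|]; rewrite ?mul0r//.
  have -> : (j == m) = false by apply: contra_neqF mi => /eqP <-; rewrite ji.
  by rewrite mulr0.
exists (\matrix_(j, l) if d j == e l then E0 (d j) j l else 0).
  by move=> j l /negPf jl; rewrite mxE jl.
set E := \matrix_(_, _) _.
rewrite -kermx_eq0; apply/eqP/row_matrixP => r; rewrite row0.
have : row r (kermx (G + E *m T)) *m (G + E *m T) = 0.
  by rewrite -row_mul mulmx_ker row0.
move: (row r _) => {r} v vG.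
apply/rowP => j0; rewrite [RHS]mxE; set i := d j0.
pose w : 'rV[K]_n := \row_j if d j == i then v 0 j else 0.
suff w0 : w = 0 by move/rowP/(_ j0): w0; rewrite !mxE eqxx.
rewrite -(mulmxK (E0P i) w) (_ : w *m _ = 0) ?mul0mx//.
apply/rowP => k; rewrite !mxE.
have [ki|ki] := eqVneq (d k) i; last first.
  rewrite big1 // => j _; rewrite !mxE (negPf ki) andbF.
  case: (eqVneq (d j) i) => [ji|]; last by rewrite mul0r.
  have -> : (j == k) = false by apply: contra_neqF ki => /eqP <-.
  by rewrite add0r big1 ?mulr0// => l _; rewrite !mxE (negPf ki) mulr0.
move/rowP/(_ k): vG; rewrite !mxE => vG; rewrite -[RHS]vG; apply: eq_bigr => j _.
rewrite !mxE ki eqxx andbT; have [ji|ji] := eqVneq (d j) i.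
  congr (_ * (_ + _)); apply: eq_bigr => l _; rewrite !mxE ki eqxx ji.
  by have [//|il] := eqVneq i (e l); rewrite Td ?mulr0 ?mul0r// ki eq_sym.
rewrite mul0r Gd ?ki// big1 ?add0r ?mulr0// => l _; rewrite !mxE.
have [jl|] := eqVneq (d j) (e l); last by rewrite mul0r.
by rewrite Td ?mulr0// -jl ki.
Qed.

(** Two families of degrees with the same distribution differ by a permutation:
    they list the same multiset. *)
Lemma same_fibres_bijection m n (d : 'I_m -> deg) (d' : 'I_n -> deg) :
  (forall i, #|[pred j | d j == i]| = #|[pred j | d' j == i]|) ->
  m = n /\ exists s : 'I_m -> 'I_n, bijective s /\ forall k, d' (s k) = d k.
Proof.
move=> dd'.
have cnt q (f : 'I_q -> deg) i : count_mem i (codom f) = #|[pred j | f j == i]|.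
  by rewrite count_map cardE enumT size_filter -enumT.
have eq_dd' : perm_eq (codom d) (codom d').
  by apply/allP => i _; apply/eqP; rewrite !cnt.
have mn : m = n by move/perm_size: eq_dd'; rewrite !size_codom !card_ord.
split=> //; subst n.
case: m d d' {dd' cnt} eq_dd' => [|m] d d' eq_dd'.
  by exists id; split=> [|[]//]; exists id.
have sz q (f : 'I_q -> deg) : size (codom f) = q by rewrite size_codom card_ord.
pose td := tcast (sz _ d) (in_tuple (codom d)).
pose td' := tcast (sz _ d') (in_tuple (codom d')).
have : perm_eq td td' by rewrite !val_tcast.
move=> /tuple_permP[s sE].
exists s; split; first by exists (s^-1)%g; [exact: permK | exact: permKV].
have nthc q (f : 'I_q -> deg) (i : 'I_q) x : nth x (codom f) i = f i.
  by rewrite (nth_map i) ?size_enum_ord // nth_ord_enum.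
move=> k; have := congr1 (fun t => nth (d ord0) t k) sE.
rewrite val_tcast nthc -tnth_nth tnth_mktuple => ->.
by rewrite (tnth_nth (d ord0)) val_tcast nthc.
Qed.

Lemma graded_stable_range m n p (d : 'I_m -> deg) (d' : 'I_n -> deg)
    (e : 'I_p -> deg) (G : 'M[K]_(m, n)) (T : 'M_(p, n)) :
  (forall i, #|[pred j | d j == i]| = #|[pred j | d' j == i]|) ->
  (forall j k, d j != d' k -> G j k = 0) ->
  (forall l k, e l != d' k -> T l k = 0) ->
  (exists A B, A *m G + B *m T = 1%:M) ->
  exists2 E : 'M_(m, p), (forall j l, d j != e l -> E j l = 0) &
    row_free (G + E *m T).
Proof.
move=> /same_fibres_bijection[mn [s [/bij_inj s_inj sd]]] Gd Td [A [B AGBT]].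
subst n; pose pi := perm s_inj; pose P : 'M[K]_m := perm_mx pi^-1.
have colE q (X : 'M[K]_(q, m)) : col_perm pi X = X *m P.
  by rewrite col_permE.
have [|||E Ed EG] := @graded_stable_range_square _ _ d e (col_perm pi G)
    (col_perm pi T) (row_perm pi A) (row_perm pi B).
- by move=> j k jk; rewrite mxE permE; apply: Gd; rewrite sd.
- by move=> l k lk; rewrite mxE permE; apply: Td; rewrite sd.
- rewrite !colE !mulmxA -mulmxDl !row_permE -!mulmxA -mulmxDr AGBT mulmx1.
  by rewrite -perm_mxM mulgV perm_mx1.
exists E => //; move: EG; rewrite !colE mulmxA -mulmxDl /row_free mxrankMfree//.
by rewrite row_free_unit unitmx_perm.
Qed.

End Graded.
End StableRange.

(** * Linear maps on the free algebra *)

Section CharacteristicTwo.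

Lemma F2_cases (c : 'F_2) : c = 0 \/ c = 1.
Proof. by case: c => -[|[|//]] k; [left|right]; exact: val_inj. Qed.

Lemma addvv (V : lmodType 'F_2) (x : V) : x + x = 0.
Proof.
by rewrite -[x]scale1r -scalerDl (_ : 1 + 1 = 0 :> 'F_2) ?scale0r//; apply/val_inj.
Qed.

Lemma oppv (V : lmodType 'F_2) (x : V) : - x = x.
Proof. by apply/eqP; rewrite eq_sym -addr_eq0 addvv. Qed.

(** Scalars of the prime field are central in any algebra, left algebras
    included. *)
Lemma F2_scalerAr (B : lalgType 'F_2) (c : 'F_2) (x y : B) :
  x * (c *: y) = c *: (x * y).
Proof. by case: (F2_cases c) => ->; rewrite ?scale0r ?mulr0// !scale1r. Qed.

Lemma scale_comb (V : lmodType 'F_2) (c p q : 'F_2) (u v : V) :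
  c *: (p *: u + q *: v) = p *: (c *: u) + q *: (c *: v).
Proof. by rewrite scalerDr !scalerA ![c * _]mulrC. Qed.

End CharacteristicTwo.

Section FreeAlgebra.
Variable n : nat.
Local Notation A := (free_algebra n).

Lemma free_algebra_ind (P : A -> Prop) :
  P 0 -> (forall x y, P x -> P y -> P (x + y)) -> (forall w, P << w >>) ->
  forall x, P x.
Proof.
move=> P0 PD Pw x; rewrite [x]monalgE; elim/big_rec: _ => // w y _ Py.
apply: PD => //; case: (F2_cases x@_w) => ->; last exact: Pw.
by rewrite raddf0.
Qed.

Lemma free_algebra_gen_ind (P : A -> Prop) :
  P 0 -> (forall x y, P x -> P y -> P (x + y)) -> P 1 ->
  (forall j x, P x -> P (gen j * x)) -> forall x, P x.
Proof.
move=> P0 PD P1 Pgen; refine (free_algebra_ind P0 PD _) => w; rewrite word_gen.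
by elim: (w : seq _) => [|j s IHs]; rewrite ?big_nil// big_cons; exact: Pgen.
Qed.

Section LinearExtension.
Variables (V : lmodType 'F_2) (h : seq 'I_n -> V).

Definition lin_ext (x : A) : V := \sum_(w <- msupp x) x@_w *: h w.

Lemma lin_extEw (d : {fset {fmonom 'I_n}}) x : (msupp x `<=` d)%fset ->
  lin_ext x = \sum_(w <- d) x@_w *: h w.
Proof.
move=> le; apply: big_fset_incl => // w _ /mcoeff_outdom ->.
by rewrite scale0r.
Qed.

Fact lin_ext_is_linear : linear lin_ext.
Proof.
move=> c x y; pose d := (msupp x `|` msupp y `|` msupp (c *: x + y))%fset.
have sx : (msupp x `<=` d)%fset by rewrite /d -fsetUA fsubsetUl.
have sy : (msupp y `<=` d)%fset by rewrite /d fsetUAC fsubsetUr.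
have sxy : (msupp (c *: x + y) `<=` d)%fset by rewrite /d fsubsetUr.
rewrite !(@lin_extEw d) // scaler_sumr -big_split; apply: eq_bigr => w _ /=.
by rewrite mcoeffD mcoeffZ scalerA scalerDl.
Qed.

HB.instance Definition _ :=
  GRing.isLinear.Build 'F_2 A V *:%R lin_ext lin_ext_is_linear.

Lemma lin_extU (w : {fmonom 'I_n}) : lin_ext << w >> = h w.
Proof.
by rewrite (@lin_extEw [fset w]%fset) ?msuppU_le// big_seq_fset1 mcoeffUU scale1r.
Qed.

Lemma lin_ext1 : lin_ext 1 = h [::].
Proof. by rewrite -[1]/(<< mone >>) lin_extU fm1. Qed.

Lemma lin_ext0 : lin_ext 0 = 0.
Proof. exact: linear0. Qed.

Lemma lin_extD : {morph lin_ext : x y / x + y}.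
Proof. exact: linearD. Qed.

End LinearExtension.

Lemma lin_ext_genM (V : lmodType 'F_2) (h : seq 'I_n -> V) a x :
  lin_ext h (gen a * x) = lin_ext (fun s => h (a :: s)) x.
Proof.
elim/free_algebra_ind: x => [|x y IHx IHy|w].
- by rewrite mulr0 !lin_ext0.
- by rewrite mulrDr !lin_extD; congr (_ + _).
by rewrite malgM_def fgmulUU mulr1 !lin_extU fmM fmU.
Qed.

Lemma lin_ext_comb (V : lmodType 'F_2) (h h1 h2 : seq 'I_n -> V) (p q : 'F_2) :
  (forall s, h s = p *: h1 s + q *: h2 s) ->
  forall x, lin_ext h x = p *: lin_ext h1 x + q *: lin_ext h2 x.
Proof.
move=> hE x; rewrite /lin_ext !scaler_sumr -big_split; apply: eq_bigr => w _ /=.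
by rewrite hE scale_comb.
Qed.

Lemma lin_ext_words x : lin_ext (fun s => \prod_(j <- s) gen j) x = x.
Proof.
elim/free_algebra_ind: x => [|x y IHx IHy|w]; first by rewrite lin_ext0.
  by rewrite lin_extD; congr (_ + _).
by rewrite lin_extU -word_gen.
Qed.

Section AlgebraExtension.
Variables (B : lalgType 'F_2) (c : 'I_n -> B).

Definition alg_ext : A -> B := lin_ext (fun s => \prod_(j <- s) c j).

HB.instance Definition _ := GRing.Linear.on alg_ext.

Lemma alg_ext_genM a x : alg_ext (gen a * x) = c a * alg_ext x.
Proof.
rewrite /alg_ext lin_ext_genM /lin_ext mulr_sumr; apply: eq_bigr => w _.
by rewrite big_cons F2_scalerAr.
Qed.

Fact alg_ext_monoid : monoid_morphism alg_ext.
Proof.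
split=> [|x y]; first by rewrite /alg_ext lin_ext1 big_nil.
elim/free_algebra_gen_ind: x => [|x z IHx IHz||a x IHx].
- by rewrite mul0r /alg_ext lin_ext0 mul0r.
- by rewrite mulrDl /alg_ext !lin_extD mulrDl; congr (_ + _).
- by rewrite mul1r /alg_ext lin_ext1 big_nil mul1r.
- apply: etrans (congr1 alg_ext (esym (mulrA (gen a) x y))) _.
  apply: etrans (alg_ext_genM a (x * y)) _.
  apply: etrans (congr1 ( *%R (c a)) IHx) _.
  apply: etrans (mulrA (c a) _ _) _.
  exact: (congr1 (fun z => z * alg_ext y) (esym (alg_ext_genM a x))).
Qed.

HB.instance Definition _ :=
  GRing.isMonoidMorphism.Build A B alg_ext alg_ext_monoid.

Lemma alg_ext_gen j : alg_ext (gen j) = c j.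
Proof. by rewrite /gen /alg_ext lin_extU fmU big_seq1. Qed.

End AlgebraExtension.

Section Fox.
Variables (e : 'I_n -> 'F_2) (j : 'I_n).

(** Fox derivative of a word for the augmentation with values e: the derivation
    D_j over e, that is D_j(uv) = D_j(u) v + e(u) D_j(v), with D_j(a_k) = 1 if
    k = j and 0 otherwise. *)
Fixpoint fox_word (s : seq 'I_n) : A :=
  if s is a :: s' then
    (j == a)%:R *: \prod_(k <- s') gen k + e a *: fox_word s'
  else 0.

Definition fox_ext : A -> A := lin_ext fox_word.

HB.instance Definition _ := GRing.Linear.on fox_ext.

Lemma fox_ext1 : fox_ext 1 = 0.
Proof. by rewrite /fox_ext lin_ext1. Qed.

Lemma fox_ext_genM a x :
  fox_ext (gen a * x) = (j == a)%:R *: x + e a *: fox_ext x.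
Proof.
apply: etrans (lin_ext_genM fox_word a x) _.
apply: etrans (@lin_ext_comb _ _ _ _ (j == a)%:R (e a) (fun s => erefl) x) _.
exact: (congr1 (fun y => (j == a)%:R *: y + e a *: fox_ext x) (lin_ext_words x)).
Qed.

End Fox.

Section Homogeneous.
Variables (r : int) (d : 'I_n -> degree r).

Definition component_ext (i : degree r) : A -> A :=
  lin_ext (fun s => if \sum_(j <- s) d j == i then \prod_(j <- s) gen j else 0).

HB.instance Definition _ i := GRing.Linear.on (component_ext i).

Lemma comp_ext1 i : component_ext i 1 = if i == 0 then 1 else 0.
Proof. by rewrite /component_ext lin_ext1 !big_nil eq_sym. Qed.

Lemma comp_ext_genM i a x :
  component_ext i (gen a * x) = gen a * component_ext (i - d a) x.
Proof.
rewrite /component_ext lin_ext_genM /lin_ext mulr_sumr; apply: eq_bigr => w _.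
rewrite F2_scalerAr !big_cons; congr (_ *: _).
have -> : (d a + \sum_(k <- w) d k == i) = (\sum_(k <- w) d k == i - d a).
  by rewrite [RHS]eq_sym subr_eq eq_sym addrC.
by case: ifP => _; rewrite ?mulr0.
Qed.

Lemma mcoeff_component_ext i x w :
  (component_ext i x)@_w = if word_degree d w == i then x@_w else 0.
Proof.
elim/free_algebra_ind: x => [|x y IHx IHy|v].
- by rewrite /component_ext lin_ext0 mcoeff0 if_same.
- apply: etrans (congr1 (mcoeff w) (lin_extD _ x y)) _.
  apply: etrans (mcoeffD _ _ _) _; apply: etrans (f_equal2 +%R IHx IHy) _.
  by case: ifP => _; rewrite ?addr0// mcoeffD.
rewrite /component_ext lin_extU -word_gen mcoeffU1.
have [<-|vw] := eqVneq v w; last first.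
  by rewrite if_same; case: ifP => _; rewrite ?mcoeff0// mcoeffU1 (negPf vw).
by rewrite /word_degree; case: ifP => _; rewrite ?mcoeff0// mcoeffU1 eqxx.
Qed.

Lemma homogeneousP i x : homogeneous d i x <-> component_ext i x = x.
Proof.
split=> [xi|xi w].
  apply/malgP => w; rewrite mcoeff_component_ext; case: eqP => // wi.
  by apply/esym/mcoeff_outdom/negP => /xi.
move=> wx; apply/eqP; apply: contraTT wx => /negPf wi.
by rewrite -mcoeff_eq0 -xi mcoeff_component_ext wi eqxx.
Qed.

End Homogeneous.
End FreeAlgebra.

(** * Augmented differential algebras and Fox calculus *)

(** What the argument uses of a graded free algebra with an augmentation eps and a
    differential d lowering degrees by s.  The generators X j are chosen in the
    kernel of eps; freeness appears as the existence of maps with prescribed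
    values on the generators and as the existence of the Fox derivatives, which
    for generators of augmentation 0 only remove the first letter.  The grading
    is given by the projections component i. *)
Record augmented_dga (G : zmodType) (s : G) := AugmentedDGA {
  rank : nat;
  alg :> lalgType 'F_2;
  X : 'I_rank -> alg;
  deg : 'I_rank -> G;
  component : G -> {linear alg -> alg};
  fox : 'I_rank -> {linear alg -> alg};
  eps : {lrmorphism alg -> 'F_2 | *%R};
  d : {linear alg -> alg};
  gen_ind : forall P : alg -> Prop, P 0 ->
    (forall x y, P x -> P y -> P (x + y)) -> P 1 ->
    (forall j x, P x -> P (X j * x)) -> forall x, P x;
  gen_map : forall (B : lalgType 'F_2) (c : 'I_rank -> B),
    exists f : {lrmorphism alg -> B}, forall j, f (X j) = c j;
  comp1 : forall i, component i 1 = if i == 0 then 1 else 0;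
  comp_genM : forall i j x, component i (X j * x) = X j * component (i - deg j) x;
  fox1 : forall j, fox j 1 = 0;
  fox_genM : forall j k x, fox j (X k * x) = (j == k)%:R *: x;
  eps_gen : forall j, eps (X j) = 0;
  leibniz : forall x y, d (x * y) = d x * y + x * d y;
  d_d : forall x, d (d x) = 0;
  eps_d : forall x, eps (d x) = 0;
  comp_d : forall i x, component (i - s) (d x) = d (component i x)
}.

Arguments X {G s} a j : rename.
Arguments deg {G s a} j : rename.
Arguments component {G s a} i : rename.
Arguments fox {G s a} j : rename.
Arguments eps {G s} a : rename.
Arguments d {G s a} : rename.
Arguments gen_ind {G s a} P : rename.
Arguments gen_map {G s} a B c : rename.
Arguments comp1 {G s} a i : rename.
Arguments comp_genM {G s a} i j x : rename.
Arguments fox1 {G s} a j : rename.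
Arguments fox_genM {G s a} j k x : rename.
Arguments eps_gen {G s a} j : rename.
Arguments leibniz {G s a} x y : rename.
Arguments d_d {G s a} x : rename.
Arguments eps_d {G s a} x : rename.
Arguments comp_d {G s a} i x : rename.

Section Theory.
Variables (G : zmodType) (s : G) (T : augmented_dga s).
Implicit Types (x y z : T) (i : G).

Lemma d1 : d (1 : T) = 0.
Proof.
have := leibniz (1 : T) 1; rewrite !mulr1 mul1r => /eqP.
by rewrite -subr_eq0 opprD addrA subrr add0r oppr_eq0 => /eqP.
Qed.

Lemma eps1 : eps T 1 = 1.
Proof. exact: rmorph1. Qed.

Lemma epsD x y : eps T (x + y) = eps T x + eps T y.
Proof. exact: linearD. Qed.

Lemma epsM x y : eps T (x * y) = eps T x * eps T y.
Proof. exact: rmorphM. Qed.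

Lemma epsZ (c : 'F_2) x : eps T (c *: x) = c * eps T x.
Proof. exact: linearZ. Qed.

Lemma foxD j x y : fox j (x + y) = fox j x + fox j y.
Proof. exact: linearD. Qed.

Lemma foxZ j (c : 'F_2) x : fox j (c *: x) = c *: fox j x.
Proof. exact: linearZ. Qed.

Lemma foxM j x y : fox j (x * y) = fox j x * y + eps T x *: fox j y.
Proof.
elim/(@gen_ind G s T): x => [|x z IHx IHz||a x IHx].
- by rewrite mul0r !linear0 mul0r scale0r addr0.
- by rewrite mulrDl !linearD scalerDl mulrDl /= IHx IHz addrACA.
- by rewrite mul1r fox1 mul0r eps1 scale1r add0r.
by rewrite -mulrA !fox_genM epsM eps_gen mul0r scale0r addr0 scalerAl.
Qed.

Lemma fox_gen j k : fox j (X T k) = (j == k)%:R%:A.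
Proof. by rewrite -[X T k]mulr1 fox_genM. Qed.

Lemma fox_expansion x : x = (eps T x)%:A + \sum_j X T j * fox j x.
Proof.
elim/(@gen_ind G s T): x => [|x y IHx IHy||a x IHx].
- by rewrite linear0 scale0r add0r big1 // => j _; rewrite linear0 mulr0.
- under eq_bigr do rewrite linearD mulrDr.
  by rewrite linearD scalerDl big_split addrACA /= -IHx -IHy.
- by rewrite eps1 scale1r big1 ?addr0// => j _; rewrite fox1 mulr0.
rewrite epsM eps_gen mul0r scale0r add0r (bigD1 a) //= fox_genM eqxx scale1r.
by rewrite big1 ?addr0// => j /negPf ja; rewrite fox_genM ja scale0r mulr0.
Qed.

Definition homog i : set T := [set x | component i x = x].

Lemma homog_sub (f : {linear T -> T}) i j :
  (forall x, component j (f x) = f (component i x)) -> forall x, homog i x -> homog j (f x).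
Proof. by move=> fc x xi; rewrite /homog /= fc xi. Qed.

Lemma comp_comp i j x : component i (component j x) = if i == j then component j x else 0.
Proof.
elim/(@gen_ind G s T): x i j => [|x y IHx IHy||a x IHx] i j.
- by rewrite !linear0 if_same.
- by rewrite !linearD /= IHx IHy; case: ifP; rewrite ?addr0.
- rewrite comp1; case: (eqVneq j 0) => [->|]; last by rewrite linear0 if_same.
  by rewrite comp1; case: ifP.
rewrite !comp_genM IHx (inj_eq (addIr _)).
by case: ifP; rewrite ?mulr0.
Qed.

Lemma comp_homog i x : homog i (component i x).
Proof. by rewrite /homog /= comp_comp eqxx. Qed.

Lemma homog_gen j : homog (deg j) (X T j).
Proof.
by rewrite /homog /= -[X in component _ X]mulr1 comp_genM subrr comp1 eqxx mulr1.
Qed.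

Lemma comp_mulhomog i j x y :
  homog i x -> component (i + j) (x * y) = x * component j y.
Proof.
move=> <-; elim/(@gen_ind G s T): x i j => [|x z IHx IHz||a x IHx] i j.
- by rewrite linear0 !mul0r linear0.
- by rewrite linearD !mulrDl linearD /= IHx IHz.
- by rewrite comp1; case: eqP => [->|_]; rewrite ?add0r ?mul1r// !mul0r linear0.
by rewrite comp_genM -!mulrA comp_genM addrAC IHx.
Qed.

Lemma homogM i j x y : homog i x -> homog j y -> homog (i + j) (x * y).
Proof. by move=> xi yj; rewrite /homog /= comp_mulhomog // yj. Qed.

Lemma comp_homog_if i j x : homog j x -> component i x = if i == j then x else 0.
Proof. by move=> xj; rewrite -xj comp_comp. Qed.

Lemma comp_fox i j x : component (i - deg j) (fox j x) = fox j (component i x).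
Proof.
elim/(@gen_ind G s T): x i => [|x y IHx IHy||a x IHx] i.
- by rewrite !linear0.
- by rewrite !linearD /= IHx IHy.
- rewrite fox1 linear0 comp1; case: ifP => _; rewrite ?linear0//.
  by rewrite fox1.
rewrite comp_genM !fox_genM linearZ /=.
by have [->|] := eqVneq j a; rewrite ?scale0r.
Qed.

Lemma eps_comp i x : eps T (component i x) = if i == 0 then eps T x else 0.
Proof.
elim/(@gen_ind G s T): x i => [|x y IHx IHy||a x IHx] i.
- by rewrite !linear0 if_same.
- by rewrite !linearD /= IHx IHy; case: ifP; rewrite ?addr0.
- by rewrite comp1; case: ifP => _; rewrite ?linear0.
by rewrite comp_genM !epsM eps_gen !mul0r if_same.
Qed.

Lemma eps_homog i x : homog i x -> i != 0 -> eps T x = 0.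
Proof. by move=> <- /negPf i0; rewrite eps_comp i0. Qed.

(** An element is a sum of homogeneous ones, although infinitely many degrees may
    exist and the sum of all components makes no sense a priori. *)
Lemma homog_split_ind (P : T -> Prop) : P 0 ->
  (forall x y, P x -> P y -> P (x + y)) -> (forall i x, homog i x -> P x) ->
  forall x, P x.
Proof.
move=> P0 PD Ph x; suff [l [xs ->]] : exists (l : seq (G * T)),
    (forall t, t \in l -> homog t.1 t.2) /\ x = \sum_(t <- l) t.2.
  elim: l xs => [|t l IHl] xs; first by rewrite big_nil.
  rewrite big_cons; apply: PD; first by apply: Ph (xs _ (mem_head _ _)).
  by apply: IHl => u ul; apply: xs; rewrite in_cons ul orbT.
elim/(@gen_ind G s T): x => [|x y [l [lh ->]] [m [mh ->]]||a x [l [lh ->]]].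
- by exists [::]; rewrite big_nil.
- exists (l ++ m); rewrite big_cat; split=> // t.
  by rewrite mem_cat => /orP[/lh|/mh].
- exists [:: (0, 1)]; rewrite big_seq1; split=> // t.
  by rewrite inE => /eqP ->; rewrite /homog /= comp1 eqxx.
exists [seq (deg a + t.1, X T a * t.2) | t <- l]; split.
  by move=> _ /mapP[t /lh th ->] /=; apply: homogM => //; exact: homog_gen.
by rewrite big_map mulr_sumr.
Qed.

Lemma comp_ideal_gen (g : set T) i x : (forall y, g y -> exists j, homog j y) ->
  x \in ideal_gen g -> component i x \in ideal_gen g.
Proof.
move=> gh /ideal_genP[l lg ->]; rewrite linear_sum big_seq.
apply: rpred_sum => t /lg; move: t.1.1 t.1.2 t.2 => {t lg} u y v gy.
have [j yj] := gh y gy.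
elim/(@homog_split_ind): u => [|x1 x2 IH1 IH2|k u uk].
- by rewrite !mul0r linear0 rpred0.
- by rewrite !mulrDl linearD rpredD.
elim/(@homog_split_ind): v => [|x1 x2 IH1 IH2|k' v vk].
- by rewrite !mulr0 linear0 rpred0.
- by rewrite !mulrDr linearD rpredD.
rewrite (comp_homog_if _ (homogM (homogM uk yj) vk)).
case: eqP => _; last exact: rpred0.
by apply: ideal_genMr; apply: ideal_genMl; exact: sub_ideal_gen.
Qed.

Definition augpow_gens m : set T :=
  [set \prod_(k < m) y k | y in [set y : 'I_m -> T | forall k, eps T (y k) = 0]].

Definition augpow m : {pred T} := ideal_gen (augpow_gens m).

HB.instance Definition _ m := GRing.ZmodClosed.on (augpow m).

Lemma augpow0 x : x \in augpow 0.
Proof.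
rewrite -[x]mulr1; apply: ideal_genMl; apply: sub_ideal_gen.
by exists (fun=> 0) => [[]//|]; rewrite big_ord0.
Qed.

Lemma augpow_genM m j x : x \in augpow m -> X T j * x \in augpow m.+1.
Proof.
move=> /ideal_genP[l lg ->]; rewrite mulr_sumr big_seq.
apply: rpred_sum => t /lg [y yA /= <-].
rewrite !mulrA; apply: ideal_genMr; apply: sub_ideal_gen.
exists (fun k => if unlift ord0 k is Some k' then y k' else X T j * t.1.1).
  move=> k; case: unliftP => [k' _|_]; first exact: yA.
  by rewrite epsM eps_gen mul0r.
rewrite big_ord_recl unlift_none; congr (_ * _).
by apply: eq_bigr => k _; rewrite liftK.
Qed.

(** Membership in a power of the augmentation ideal is tested one letter at a time,
    which replaces a description of M^m by monomials. *)
Lemma augpowS m x :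
  x \in augpow m.+1 <-> eps T x = 0 /\ forall j, fox j x \in augpow m.
Proof.
split=> [|[ex fx]]; last first.
  rewrite (fox_expansion x) ex scale0r add0r; apply: rpred_sum => j _.
  exact: augpow_genM.
move=> /ideal_genP[l lg ->].
suff lP t : t \in l -> eps T (t.1.1 * t.1.2 * t.2) = 0 /\
    forall j, fox j (t.1.1 * t.1.2 * t.2) \in augpow m.
  rewrite linear_sum; split=> [|j]; first by rewrite big_seq big1 // => t /lP[].
  by rewrite linear_sum big_seq rpred_sum // => t /lP[_].
move=> /lg; move: t.1.1 t.1.2 t.2 => u _ v [y yM <-].
have y0 : eps T (u * y ord0) = 0 by rewrite epsM yM mulr0.
rewrite big_ord_recl mulrA -mulrA; split=> [|j]; first by rewrite epsM y0 mul0r.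
rewrite foxM y0 scale0r addr0; apply: ideal_genMl; apply: ideal_genMr.
by apply: sub_ideal_gen; exists (fun k => y (lift ord0 k)).
Qed.

Lemma augpowW m x : x \in augpow m.+1 -> x \in augpow m.
Proof.
elim: m x => [|m IHm] x; first by move=> _; exact: augpow0.
by move=> /augpowS[ex fx]; apply/augpowS; split=> // j; exact: IHm.
Qed.

Lemma augpow1 x : x \in augpow 1 <-> eps T x = 0.
Proof. by rewrite augpowS; split=> [[]//|]; split=> // j; exact: augpow0. Qed.

Lemma augpow_comp m i x : x \in augpow m -> component i x \in augpow m.
Proof.
elim: m i x => [|m IHm] i x; first by move=> _; exact: augpow0.
move=> /augpowS[ex fx]; apply/augpowS; split=> [|j].
  by rewrite eps_comp ex if_same.
by rewrite -comp_fox; exact: IHm.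
Qed.

Lemma augpow_fin_spanned m : exists n (v : 'I_n -> T), forall x,
  exists c : 'I_n -> 'F_2, x - \sum_i c i *: v i \in augpow m.
Proof.
elim: m => [|m [n [v vP]]].
  by exists 0%N, (fun=> 0) => x; exists (fun=> 0); exact: augpow0.
pose I : finType := option ('I_(rank T) * 'I_n)%type.
pose V (t : I) := if t is Some (j, i) then X T j * v i else 1.
exists #|I|, (V \o enum_val) => x.
have /choice[c cP] : forall j, exists c : 'I_n -> 'F_2,
  fox j x - \sum_i c i *: v i \in augpow m by move=> j; exact: vP.
pose C (t : I) := if t is Some (j, i) then c j i else eps T x.
exists (C \o enum_val).
rewrite [X in x - X](_ : _ =
    (eps T x)%:A + \sum_j X T j * \sum_i c j i *: v i); last first.
  rewrite -(big_enum_val (fun t => C t *: V t)) (bigD1 None) //=; congr (_ + _).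
  rewrite (reindex_omap (op := +%R) Some id) => [|[]//] /=.
  rewrite (eq_bigl xpredT) => [|t]; last by rewrite !eqxx.
  transitivity (\sum_j \sum_i c j i *: (X T j * v i)).
    by rewrite pair_bigA; apply: eq_bigr => -[j i] _.
  apply: eq_bigr => j _.
  by rewrite mulr_sumr; apply: eq_bigr => i _; rewrite F2_scalerAr.
rewrite {1}(fox_expansion x) opprD addrACA subrr add0r -sumrB.
by apply: rpred_sum => j _; rewrite -mulrBr; exact: augpow_genM.
Qed.

End Theory.

(** * The characteristic ideal modulo the third power *)

Section CharacteristicIdeal.
Variables (G : zmodType) (s : G) (T : augmented_dga s).
Implicit Types (x y z u v g : T) (i : G).

Lemma augpowM m n x y : x \in augpow m -> y \in augpow n ->
  x * y \in augpow (m + n).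
Proof.
elim: m x => [|m IHm] x; first by move=> _; exact: ideal_genMl.
move=> /augpowS[ex fx] yn; apply/augpowS; split=> [|j].
  by rewrite epsM ex mul0r.
by rewrite foxM ex scale0r addr0; exact: IHm.
Qed.

(** Coordinates of the linear and of the quadratic part of x: the matrix of quad x
    represents the element of V (x) V, with V = M / M^2, given by M^2 / M^3. *)
Definition ell x : 'rV['F_2]_(rank T) := \row_j eps T (fox j x).
Definition quad x : 'M['F_2]_(rank T) := \matrix_(j, k) eps T (fox k (fox j x)).

Fact ell_is_linear : linear ell.
Proof. by move=> c x y; apply/rowP => j; rewrite !mxE !linearP. Qed.
HB.instance Definition _ := GRing.isLinear.Build 'F_2 T _ *:%R ell ell_is_linear.

Fact quad_is_linear : linear quad.
Proof. by move=> c x y; apply/matrixP => j k; rewrite !mxE !linearP. Qed.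
HB.instance Definition _ := GRing.isLinear.Build 'F_2 T _ *:%R quad quad_is_linear.

Lemma augpow2P x : x \in augpow 2 <-> eps T x = 0 /\ ell x = 0.
Proof.
rewrite augpowS; split=> -[ex fx]; split=> //.
  by apply/rowP => j; rewrite !mxE; exact/augpow1.
by move=> j; apply/augpow1; have /rowP/(_ j) := fx; rewrite !mxE.
Qed.

Lemma augpow3P x : x \in augpow 3 <-> [/\ eps T x = 0, ell x = 0 & quad x = 0].
Proof.
rewrite augpowS; split=> [[ex fx]|[ex lx qx]]; split=> //.
- by apply/rowP => j; rewrite !mxE; have /augpow2P[] := fx j.
- apply/matrixP => j k; rewrite !mxE; have /augpow2P[_ /rowP/(_ k)] := fx j.
  by rewrite !mxE.
move=> j; apply/augpow2P; split; first by have /rowP/(_ j) := lx; rewrite !mxE.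
by apply/rowP => k; have /matrixP/(_ j k) := qx; rewrite !mxE.
Qed.

Lemma ellM x y : ell (x * y) = eps T y *: ell x + eps T x *: ell y.
Proof.
by apply/rowP => j; rewrite !mxE foxM epsD epsM epsZ mulrC.
Qed.

Lemma quadM x y : eps T x = 0 -> eps T y = 0 ->
  quad (x * y) = (ell x)^T *m ell y.
Proof.
move=> ex ey; apply/matrixP => j k; rewrite !mxE big_ord1 !mxE.
by rewrite foxM ex scale0r addr0 foxM epsD epsM epsZ ey mulr0 add0r.
Qed.

Lemma ell_sandwich u g v : eps T g = 0 ->
  ell (u * g * v) = (eps T u * eps T v) *: ell g.
Proof.
move=> eg; rewrite !ellM epsM eg mulr0 !scale0r addr0 add0r scalerA.
by rewrite [eps T v * _]mulrC.
Qed.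

Lemma quad_sandwich u g v : eps T g = 0 ->
  quad (u * g * v) = eps T v *: ((ell u)^T *m ell g) +
    (eps T u * eps T v) *: quad g + eps T u *: ((ell g)^T *m ell v).
Proof.
move=> eg; apply/matrixP => j k; rewrite !mxE !big_ord1 !mxE.
rewrite foxM epsM eg mulr0 scale0r addr0 [fox j (u * g)]foxM mulrDl foxD epsD.
rewrite -scalerAl foxZ epsZ !foxM !epsD !epsZ !epsM !epsD !epsM epsZ eg.
rewrite !mulr0 !add0r mulrDr addrA; congr (_ + _ + _).
  by rewrite mul0r addr0 mulrC.
by rewrite -mulrA [_ * eps T v]mulrC.
Qed.

(** The linear part of the differential, acting on row vectors on the right. *)
Definition dmx : 'M['F_2]_(rank T) := \matrix_j ell (d (X T j)).

Lemma ell_gen j : ell (X T j) = delta_mx 0 j.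
Proof.
apply/rowP => k; rewrite !mxE fox_gen epsZ eps1 mulr1 eqxx /=.
by rewrite eq_sym.
Qed.

Lemma ell_d x : ell (d x) = ell x *m dmx.
Proof.
rewrite {1}(fox_expansion x) linearD linearZ /= d1 scaler0 add0r !linear_sum /=.
transitivity (\sum_j eps T (fox j x) *: row j dmx).
  apply: eq_bigr => j _; rewrite leibniz linearD /= !ellM.
  by rewrite !eps_d eps_gen !scale0r !addr0 rowK.
rewrite mulmx_sum_row; apply: eq_bigr => j _.
by rewrite mxE.
Qed.

Lemma dmx_dmx : dmx *m dmx = 0.
Proof.
apply/row_matrixP => j; rewrite row_mul rowK -ell_d d_d.
by rewrite linear0 row0.
Qed.

(** The differential of V (x) V is d_1 (x) 1 + 1 (x) d_1, without signs in
    characteristic two. *)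
Lemma quad_d x : x \in augpow 2 ->
  quad (d x) = dmx^T *m quad x + quad x *m dmx.
Proof.
move=> /augpowS[ex fx]; rewrite (fox_expansion x) ex scale0r add0r !linear_sum /=.
rewrite mulmx_suml -big_split; apply: eq_bigr => j _ /=.
have /augpow1 ey := fx j; rewrite leibniz linearD /= !quadM ?eps_d ?eps_gen //.
by rewrite !ell_d trmx_mul !mulmxA.
Qed.

Lemma quad_surj (W : 'M['F_2]_(rank T)) :
  exists2 z, z \in augpow 2 & quad z = W.
Proof.
exists (\sum_j X T j * \sum_k W j k *: X T k).
  apply: rpred_sum => j _; apply: (@augpowM 1 1); apply/augpow1.
    exact: eps_gen.
  by rewrite linear_sum big1 // => k _; rewrite linearZ /= eps_gen mulr0.
rewrite linear_sum [RHS]matrix_sum_delta; apply: eq_bigr => j _ /=.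
rewrite quadM ?eps_gen//; last first.
  by rewrite linear_sum big1 // => k _; rewrite linearZ /= eps_gen mulr0.
rewrite linear_sum mulmx_sumr; apply: eq_bigr => k _ /=.
by rewrite linearZ /= !ell_gen -scalemxAr trmx_delta mul_delta_mx.
Qed.

Definition charI : {pred T} := ideal_gen [set d (X T j) | j in [set: 'I_(rank T)]].

HB.instance Definition _ := GRing.ZmodClosed.on charI.

Definition charI_square : {pred T} :=
  ideal_gen [set x * y | x in [set x | x \in charI] & y in [set y | y \in charI]].

HB.instance Definition _ := GRing.ZmodClosed.on charI_square.

Lemma d_homog i x : homog i x -> homog (i - s) (d x).
Proof. by move=> xi; rewrite /homog /= comp_d xi. Qed.

Lemma comp_charI i x : x \in charI -> component i x \in charI.
Proof.
apply: comp_ideal_gen => _ [j _ <-]; exists (deg j - s).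
by apply: d_homog; exact: homog_gen.
Qed.

Lemma d_charI x : d x \in charI.
Proof.
elim/(@gen_ind G s T): x => [|x y IHx IHy||a x IHx].
- by rewrite linear0 rpred0.
- by rewrite linearD rpredD.
- by rewrite d1 rpred0.
rewrite leibniz rpredD //; last exact: ideal_genMl.
by apply: ideal_genMr; apply: sub_ideal_gen; exists a.
Qed.

Lemma charI_eps x : x \in charI -> eps T x = 0.
Proof.
move=> /ideal_genP[l lg ->]; rewrite linear_sum big_seq big1 // => t /lg [j _ <-].
by rewrite /= !epsM eps_d mulr0 mul0r.
Qed.

Lemma d_charI_charI2 x : x \in charI -> d x \in charI_square.
Proof.
move=> /ideal_genP[l lg ->]; rewrite linear_sum big_seq.
apply: rpred_sum => t /lg [j _ <-] /=.
rewrite !leibniz d_d mulr0 addr0.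
have dI : d (X T j) \in charI by exact: d_charI.
apply: rpredD; apply: sub_ideal_gen.
  exists (d t.1.1); first exact: d_charI.
  by exists (d (X T j) * t.2); [exact: ideal_genMr | rewrite mulrA].
exists (t.1.1 * d (X T j)); first exact: ideal_genMl.
by exists (d t.2) => //; exact: d_charI.
Qed.

(** Modulo M^3 an element of I is a boundary d z plus an element of
    B (x) V + V (x) B, where B is the row space of dmx: expand u (d x_j) v
    according to u = eps u + u' and v = eps v + v'. *)
Lemma charI_mod3 x : x \in charI ->
  exists z, [/\ x - d z \in augpow 2 &
    exists Y Z, quad (x - d z) = dmx^T *m Y + Z *m dmx].
Proof.
move=> /ideal_genP[l lg ->].
elim: l lg => [|t l IHl] lg.
  exists 0; rewrite big_nil linear0 subrr rpred0; split=> //.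
  by exists 0, 0; rewrite linear0 mulmx0 mul0mx addr0.
have [|z [zP [Y [Z zYZ]]]] := IHl; first by move=> u ul; apply: lg; rewrite in_cons ul orbT.
have [j _ tj] := lg t (mem_head _ _).
set u := t.1.1; set v := t.2.
pose c := eps T u * eps T v; pose w := c *: X T j.
rewrite big_cons -tj -/u -/v; exists (w + z).
have eg : eps T (d (X T j)) = 0 by exact: eps_d.
have dw : d w = c *: d (X T j) by rewrite linearZ.
have -> (a : T) : u * d (X T j) * v + a - d (w + z) =
    (u * d (X T j) * v - d w) + (a - d z) by rewrite linearD opprD addrACA.
have uv2 : u * d (X T j) * v - d w \in augpow 2.
  apply/augpow2P; rewrite dw; split; rewrite linearB /=.
    by rewrite epsZ !epsM eg mulr0 mul0r mulr0 subrr.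
  by rewrite ell_sandwich // linearZ subrr.
split; first exact: rpredD.
exists (eps T u *: ((ell (X T j))^T *m ell v) + Y),
  (eps T v *: ((ell u)^T *m ell (X T j)) + Z).
rewrite linearD /= zYZ linearB /= quad_sandwich // dw linearZ /=.
rewrite mulmxDr mulmxDl -scalemxAr -scalemxAl -mulmxA -ell_d [_ *m (_ *m ell v)]mulmxA.
rewrite -trmx_mul -ell_d -/c [RHS]addrACA; congr (_ + _).
by rewrite addrAC addrK addrC.
Qed.

(** Matrices X stand for elements of V (x) V with differential D^T X + X D.  With
    P = 1 - D H - H D, which satisfies P D = D P = 0, the operator
    W(X) = H^T X + P^T X H is h (x) 1 + p (x) h; it is a homotopy between the
    identity and p (x) p, and p (x) p kills B (x) V + V (x) B. *)
Lemma homotopy_matrix n (D H X Y Z : 'M['F_2]_n) :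
  D *m D = 0 -> D *m H *m D = D -> X = D^T *m Y + Z *m D ->
  D^T *m X + X *m D = 0 -> exists W, X = D^T *m W + W *m D.
Proof.
move=> DD DHD XE dX; pose P := 1%:M - D *m H - H *m D.
have PD : P *m D = 0.
  by rewrite !mulmxBl mul1mx DHD -mulmxA DD mulmx0 subrr subr0.
have DP : D *m P = 0.
  by rewrite !mulmxBr mulmx1 !mulmxA DD DHD mul0mx subr0 subrr.
have PTD : P^T *m D^T = 0 by rewrite -trmx_mul DP trmx0.
have DTP : D^T *m P^T = 0 by rewrite -trmx_mul PD trmx0.
have PX : P^T *m X *m H *m D = P^T *m X.
  rewrite XE mulmxDr !mulmxA PTD mul0mx add0r -!mulmxA.
  by rewrite [D *m (H *m D)]mulmxA DHD.
have DX : X *m D = D^T *m X.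
  by apply/eqP; rewrite -subr_eq0 oppv addrC dX.
exists (H^T *m X + P^T *m X *m H).
rewrite mulmxDr mulmxDl PX -!mulmxA DX !mulmxA DTP !mul0mx addr0.
rewrite addrA -!mulmxDl.
suff -> : D^T *m H^T + H^T *m D^T + P^T = 1%:M by rewrite mul1mx.
rewrite -!trmx_mul -!linearD /= -[RHS]trmx1; congr (_^T).
by rewrite /P -[1%:M - _ - _]addrA -opprD [X in _ - X]addrC [LHS]addrC subrK.
Qed.

Lemma d_exact_mod2 x : x \in charI -> exists z, x - d z \in augpow 2.
Proof. by move=> /charI_mod3[z [zP _]]; exists z. Qed.

(** The correction z + w is found in two steps: charI_mod3 reduces to an element
    of M^2, whose quadratic part is then made a boundary by the homotopy. *)
Lemma d_exact_mod3 x : x \in charI -> d x \in augpow 3 ->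
  exists z, x - d z \in augpow 3.
Proof.
move=> /charI_mod3[z [zP [Y [Z zYZ]]]] dx.
have dxz : d (x - d z) \in augpow 3 by rewrite linearB d_d subr0.
have [_ _ qd] : [/\ eps T (d (x - d z)) = 0, ell (d (x - d z)) = 0
  & quad (d (x - d z)) = 0] by exact/augpow3P.
rewrite quad_d // in qd.
(* Any partial inverse of dmx serves as contracting homotopy. *)
have DHD : dmx *m pinvmx dmx *m dmx = dmx by rewrite mulmxKpV.
have [W WE] := homotopy_matrix dmx_dmx DHD zYZ qd.
have [w wP qw] := quad_surj W.
exists (z + w); rewrite linearD opprD addrA; apply/augpow3P.
have /augpow2P[e2 l2] := zP; have dw : d w \in augpow 2.
  by apply/augpow2P; rewrite eps_d ell_d; have /augpow2P[_ ->] := wP; rewrite mul0mx.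
have /augpow2P[e3 l3] := dw; split; rewrite linearB /=.
- by rewrite e2 e3 subrr.
- by rewrite l2 l3 subrr.
by rewrite quad_d // qw WE subrr.
Qed.

(** If p and q in I are congruent to d w and d w' modulo M^2, then p q is congruent
    to (d w) (d w') = d (w d w') modulo M^3, and w d w' lies in I. *)
Lemma charI2_mod3 y : y \in charI_square ->
  exists2 z, z \in charI & y - d z \in augpow 3.
Proof.
move=> /ideal_genP[l lg ->].
elim: l lg => [|t l IHl] lg.
  by exists 0; rewrite ?rpred0// big_nil linear0 subrr rpred0.
have [|z zI zP] := IHl; first by move=> u ul; apply: lg; rewrite in_cons ul orbT.
have [x xI [x' x'I tx]] := lg t (mem_head _ _).
have {xI} xI : t.1.1 * x \in charI by exact: ideal_genMl.
have {x'I} x'I : x' * t.2 \in charI by exact: ideal_genMr.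
have [w wP] := d_exact_mod2 xI; have [w' w'P] := d_exact_mod2 x'I.
exists (w * d w' + z); first by rewrite rpredD // ideal_genMl // d_charI.
rewrite big_cons linearD opprD addrACA; apply: rpredD => //.
rewrite leibniz d_d mulr0 addr0 -tx.
have -> : t.1.1 * (x * x') * t.2 - d w * d w' =
    (t.1.1 * x - d w) * (x' * t.2) + d w * (x' * t.2 - d w').
  by rewrite mulrBl mulrBr addrA subrK !mulrA.
apply: rpredD; first by apply: (@augpowM 2 1) => //; apply/augpow1/charI_eps.
by apply: (@augpowM 1 2) => //; apply/augpow1/eps_d.
Qed.

End CharacteristicIdeal.

(** * Cycles, boundaries and the characteristic ideal *)

Section Truncation.
Variables (G : zmodType) (s : G) (T : augmented_dga s) (n : nat).
Implicit Types (x y z : T) (i : G).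

Lemma d_augpow m x : x \in augpow m -> d x \in augpow m.
Proof.
elim: m x => [|m IHm] x; first by move=> _; exact: augpow0.
move=> /augpowS[ex fx]; rewrite (fox_expansion x) ex scale0r add0r linear_sum.
apply: rpred_sum => j _; rewrite leibniz; apply: rpredD.
  by apply: (@augpowM _ _ _ 1) => //; apply/augpow1/eps_d.
by apply: augpow_genM; exact: IHm.
Qed.

Notation Q := (quot_alg (@augpow_gens G s T n.+1)).
Notation pr := (proj (@augpow_gens G s T n.+1)).

Lemma pr_eq0 x : pr x = 0 <-> x \in augpow n.+1.
Proof.
rewrite -(linear0 pr); split=> [/eqP|xP]; last apply/eqP; rewrite proj_eq subr0//.
Qed.

Lemma pr_eq x y : x - y \in augpow n.+1 -> pr x = pr y.
Proof. by move=> xy; apply/eqP; rewrite proj_eq. Qed.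

Definition tdiff (q : Q) : Q := pr (d (repr q)).

Lemma tdiff_pr x : tdiff (pr x) = pr (d x).
Proof. by apply: pr_eq; rewrite -linearB; apply: d_augpow; exact: repr_proj. Qed.

Fact tdiff_is_linear : linear tdiff.
Proof.
move=> c p q; rewrite -[p]proj_repr -[q]proj_repr -linearP !tdiff_pr.
by rewrite !linearP.
Qed.

HB.instance Definition _ := GRing.isLinear.Build 'F_2 Q Q *:%R tdiff tdiff_is_linear.

Lemma fin_spanned_trunc (S : set Q) : fin_spanned S.
Proof.
have [e [v vP]] := @augpow_fin_spanned G s T n.+1.
exists e, (fun k => pr (v k)) => q _; have [c cP] := vP (repr q); exists c.
rewrite -[q]proj_repr (pr_eq cP) linear_sum; apply: eq_bigr => i _.
by rewrite linearZ.
Qed.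

Lemma submod_homog (P : {pred T}) i : zmod_closed P ->
  submod [set x | x \in P /\ homog i x].
Proof.
move=> [P0 PB]; split=> [|c x y [xP xi] [yP yi]].
  by split=> //; rewrite /homog /= linear0.
split; last by rewrite /homog /= linearP xi yi.
case: (F2_cases c) => ->; rewrite ?scale0r ?add0r// scale1r.
by rewrite -[y]oppv PB.
Qed.

(** These are subspaces of the algebra itself, so that maps between algebras apply
    to them; the spaces of interest are their images modulo M^(n+1). *)
Definition C_ i := [set x : T | x \in augpow 1 /\ homog i x].
Definition J_ i := [set x : T | x \in @charI G s T /\ homog i x].
Definition K_ i := [set x : T | x \in @charI_square G s T /\ homog i x].

Lemma submod_C i : submod (C_ i).
Proof. by apply: submod_homog; exact: ideal_gen_zmod_closed. Qed.

Lemma submod_J i : submod (J_ i).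
Proof. by apply: submod_homog; exact: ideal_gen_zmod_closed. Qed.

Lemma submod_K i : submod (K_ i).
Proof. by apply: submod_homog; exact: ideal_gen_zmod_closed. Qed.

Definition trunc_dim (S : set T) := lin_dim (pr @` S).

Definition cycles i := [set q | (pr @` C_ i) q /\ tdiff q = 0].
Definition boundaries i := tdiff @` (pr @` C_ (i + s)).

Lemma dim_C i : trunc_dim (C_ i) =
  (lin_dim (cycles i) + lin_dim (boundaries (i - s)))%N.
Proof.
rewrite /trunc_dim (rank_nullity tdiff (submod_image pr (submod_C i)) (@fin_spanned_trunc _)).
by rewrite /boundaries subrK.
Qed.

Hypothesis n12 : n = 1%N \/ n = 2%N.

Lemma d_exact x : x \in @charI G s T -> d x \in @augpow G s T n.+1 ->
  exists z, x - d z \in @augpow G s T n.+1.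
Proof.
case: n12 => -> xI dx; last exact: d_exact_mod3.
exact: d_exact_mod2.
Qed.

(** The key identity: on the image of I, the kernel of the differential consists of
    the boundaries, and its image is that of I^2. *)
Lemma dim_J i : trunc_dim (J_ i) =
  (lin_dim (boundaries i) + trunc_dim (K_ (i - s)))%N.
Proof.
rewrite /trunc_dim (rank_nullity tdiff (submod_image pr (submod_J i)) (@fin_spanned_trunc _)).
apply: (f_equal2 addn); apply: (congr1 (@lin_dim _ _)); apply/seteqP; split=> q.
(* A primitive z of x may be inhomogeneous with eps z != 0; both are repaired
   without changing the boundary in degree i. *)
- move=> [[x [xI xi] <-]] /=; rewrite tdiff_pr => /pr_eq0 dx.
  have [z zP] := d_exact xI dx.
  pose z' := component (i + s) (z - (eps T z)%:A).
  have dz' : x - d z' = component i (x - d z).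
    rewrite linearB xi -comp_d addrK; congr (_ - component i _).
    by rewrite linearB linearZ /= d1 scaler0 subr0.
  exists (pr z').
    exists z' => //; split; last exact: comp_homog.
    apply/augpow1; rewrite eps_comp linearB /= epsZ eps1 mulr1 subrr.
    by rewrite if_same.
  by rewrite tdiff_pr; apply/esym/pr_eq; rewrite dz'; exact: augpow_comp.
- move=> [_ [z [_ zi] <-] <-]; rewrite !tdiff_pr; split.
    exists (d z) => //; split; first exact: d_charI.
    by have := d_homog zi; rewrite addrK.
  by rewrite /= tdiff_pr d_d linear0.
- move=> [_ [x [xI xi] <-] <-] /=; rewrite tdiff_pr; exists (d x) => //.
  by split; [exact: d_charI_charI2 | exact: d_homog].
- move=> [y [yI yi] <-]; have [z zI zP] := charI2_mod3 yI.
  exists (pr (component i z)).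
    by exists (component i z) => //; split; [exact: comp_charI | exact: comp_homog].
  rewrite /= tdiff_pr; apply/esym/pr_eq.
  have -> : y - d (component i z) = component (i - s) (y - d z).
    by rewrite linearB yi comp_d.
  apply: augpow_comp; case: n12 => ->; first exact: augpowW.
  exact: zP.
Qed.

End Truncation.

Arguments C_ {G s T} i.
Arguments J_ {G s T} i.
Arguments K_ {G s T} i.

(** * Lifting maps of characteristic algebras *)

Section FilteredMaps.
Variables (G : zmodType) (s : G) (T T' : augmented_dga s).
Variable phi : {lrmorphism T -> T'}.
Hypothesis eps_phi_gen : forall j, eps T' (phi (X T j)) = 0.

Lemma eps_phi x : eps T' (phi x) = eps T x.
Proof.
elim/(@gen_ind G s T): x => [|x y IHx IHy||a x IHx].
- by rewrite !linear0.
- by rewrite !linearD /= IHx IHy.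
- by rewrite rmorph1 !eps1.
by rewrite rmorphM !epsM /= eps_phi_gen eps_gen !mul0r.
Qed.

Lemma phi_expansion x : eps T x = 0 ->
  phi x = \sum_j phi (X T j) * phi (fox j x).
Proof.
move=> ex; rewrite {1}(fox_expansion x) ex scale0r add0r linear_sum.
by apply: eq_bigr => j _; rewrite rmorphM.
Qed.

Lemma ell_phi x : eps T x = 0 ->
  ell (phi x) = ell x *m \matrix_j ell (phi (X T j)).
Proof.
move=> ex; rewrite phi_expansion // linear_sum mulmx_sum_row.
apply: eq_bigr => j _ /=; rewrite ellM eps_phi_gen scale0r addr0 eps_phi rowK.
by rewrite mxE.
Qed.

Lemma phi_homog : (forall j, homog (deg j) (phi (X T j))) ->
  forall i x, homog i x -> homog i (phi x).
Proof.
move=> phih; suff phic x i : component i (phi x) = phi (component i x).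
  by move=> i x xi; rewrite /homog /= phic xi.
elim/(@gen_ind G s T): x i => [|x y IHx IHy||a x IHx] i.
- by rewrite !linear0.
- by rewrite !linearD /= IHx IHy.
- by rewrite comp1 rmorph1 comp1; case: ifP; rewrite ?rmorph1 ?linear0.
rewrite comp_genM !rmorphM /= -IHx -(comp_mulhomog _ _ (phih a)).
by rewrite addrC subrK.
Qed.

Lemma phi_augpow m x : x \in augpow m -> phi x \in augpow m.
Proof.
elim: m x => [|m IHm] x; first by move=> _; exact: augpow0.
move=> /augpowS[ex fx]; rewrite phi_expansion //; apply: rpred_sum => j _.
by apply: (@augpowM _ _ _ 1); [exact/augpow1 | exact: IHm].
Qed.

Hypothesis ell_free : row_free (\matrix_j ell (phi (X T j))).

(** Injectivity on the associated graded algebra of the M-adic filtration follows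
    from injectivity in degree one.  If x lies in M^m, then modulo M'^m the Fox
    derivatives of phi x are the combinations of the phi (fox j x) given by the
    matrix of the linear part, and a right inverse of this matrix recovers each
    phi (fox l x). *)
Lemma phi_augpow_inj m x : phi x \in augpow m -> x \in augpow m.
Proof.
elim: m x => [|[|m] IHm] x phix; first exact: augpow0.
  by apply/augpow1; rewrite -eps_phi; apply/augpow1.
have xm : x \in augpow m.+1 by apply: IHm; exact: augpowW.
have /augpowS[ex fx] := xm; apply/augpowS; split=> // l; apply: IHm.
have /row_freeP[H GH] := ell_free.
have sumG k : \sum_j ell (phi (X T j)) 0 k *: phi (fox j x) \in augpow m.+1.
  have /augpowS[_ /(_ k)] := phix; rewrite phi_expansion // linear_sum /=.
  rewrite -[X in X \in _ -> _](subrK (\sum_j ell (phi (X T j)) 0 k *: phi (fox j x))).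
  rewrite rpredDl // -sumrB; apply: rpred_sum => j _.
  rewrite foxM eps_phi_gen scale0r addr0 mxE.
  rewrite -[X in _ - _ *: X]mul1r [_ *: (1 * _)]scalerAl -mulrBl.
  apply: (@augpowM _ _ _ 1); last by apply: phi_augpow.
  by apply/augpow1; rewrite linearB /= epsZ eps1 mulr1 subrr.
have -> : phi (fox l x) =
    \sum_k H k l *: \sum_j ell (phi (X T j)) 0 k *: phi (fox j x).
  under eq_bigr do rewrite scaler_sumr.
  rewrite exchange_big /=.
  transitivity (\sum_j (1%:M : 'M_(rank T)) j l *: phi (fox j x)).
    rewrite (bigD1 l) //= mxE eqxx scale1r big1 ?addr0// => j /negPf jl.
    by rewrite mxE jl scale0r.
  apply: eq_bigr => j _; rewrite -GH mxE scaler_suml; apply: eq_bigr => k _.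
  by rewrite scalerA !mxE mulrC.
by apply: rpred_sum => k _; exact: ideal_genZ.
Qed.

End FilteredMaps.

(** F and F' present the characteristic algebras of T and T' as the same ring B,
    so that no quotient has to be mentioned. *)
Section Lift.
Variables (G : zmodType) (s : G) (T T' : augmented_dga s) (B : pzRingType).
Variables (F : {rmorphism T -> B}) (F' : {rmorphism T' -> B}).
Hypothesis same_degrees : forall i,
  #|[pred j : 'I_(rank T) | deg j == i]| = #|[pred j : 'I_(rank T') | deg j == i]|.
Hypothesis F_d : forall j, F (d (X T j)) = 0.
Hypothesis F'_eq0 : forall y : T', F' y = 0 <-> y \in @charI G s T'.
Hypothesis F_homog : forall i (x : T), homog i x ->
  exists2 y : T', homog i y & F' y = F x.
Hypothesis F_surj : forall y : T', exists x, F x = F' y.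
Hypothesis F_eps : forall x y, F x = F' y -> eps T x = eps T' y.

Lemma charI_ell (y : T') : y \in @charI G s T' -> exists w, ell y = w *m @dmx G s T'.
Proof.
move=> /d_exact_mod2[z /augpow2P[_ yz]]; exists (ell z); rewrite -ell_d.
by apply: subr0_eq; rewrite -yz linearB.
Qed.

Lemma ell_homog (S : augmented_dga s) i (y : S) k :
  homog i y -> i != deg k -> ell y 0 k = 0.
Proof.
move=> yi ik; rewrite mxE; apply: (@eps_homog _ _ _ (i - deg k)).
  by apply: (homog_sub (i := i)) yi => x; exact: comp_fox.
by rewrite subr_eq0.
Qed.

(** The linear parts of homogeneous lifts c j form a matrix G0 which, with the rows
    of dmx, generates everything: the generator X k of T' is congruent modulo I'
    to phi0 x for some x in M.  The matrix E of [graded_stable_range] tells by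
    which elements of I' the lifts have to be changed. *)
Lemma exists_lift : exists phi : {lrmorphism T -> T'},
  [/\ forall j, eps T' (phi (X T j)) = 0,
      forall j, homog (deg j) (phi (X T j)),
      row_free (\matrix_j ell (phi (X T j))) &
      forall x, F' (phi x) = F x].
Proof.
have liftF (phi : {lrmorphism T -> T'}) :
    (forall j, F' (phi (X T j)) = F (X T j)) -> forall x, F' (phi x) = F x.
  move=> phiX; elim/(@gen_ind G s T) => [|x y IHx IHy||a x IHx].
  - by rewrite !raddf0.
  - by rewrite !raddfD /= IHx IHy.
  - by rewrite !rmorph1.
  by rewrite !rmorphM /= IHx phiX.
have /choice[c cP] : forall j, exists y : T', homog (deg j) y /\ F' y = F (X T j).
  by move=> j; have [y] := F_homog (homog_gen (T := T) j); exists y.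
have eps_c j : eps T' (c j) = 0.
  by rewrite -(F_eps (esym (cP j).2)) eps_gen.
have [phi0 phi0X] := gen_map T T' c.
have F_phi0 x : F' (phi0 x) = F x by apply: liftF => j; rewrite phi0X (cP j).2.
pose G0 := \matrix_j ell (c j).
have /choice[ab abP] : forall k, exists ab : 'rV_(rank T) * 'rV_(rank T'),
    ab.1 *m G0 + ab.2 *m @dmx G s T' = delta_mx 0 k.
  move=> k; have [x Fx] := F_surj (X T' k).
  have ex : eps T x = 0 by rewrite (F_eps Fx) eps_gen.
  have : X T' k - phi0 x \in @charI G s T'.
    by apply/F'_eq0; rewrite raddfB /= F_phi0 Fx subrr.
  move=> /charI_ell[w wE]; exists (ell x, w) => /=.
  rewrite -wE linearB /= ell_gen ell_phi => [|j|//]; last by rewrite phi0X.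
  have -> : \matrix_j ell (phi0 (X T j)) = G0.
    by apply/row_matrixP => j; rewrite !rowK phi0X.
  by rewrite addrC subrK.
have [|||E Ed Efree] := @graded_stable_range _ _ _ _ _ deg deg
    (fun p : 'I_(rank T') => deg p - s) G0 (@dmx G s T') same_degrees.
- by move=> j k jk; rewrite mxE; exact: ell_homog (cP j).1 jk.
- move=> p k pk; rewrite mxE; apply: ell_homog pk.
  by apply: d_homog; exact: homog_gen.
- exists (\matrix_k (ab k).1), (\matrix_k (ab k).2).
  apply/row_matrixP => k; rewrite linearD /= !row_mul !rowK abP.
  by rewrite row1.
pose e j : T' := \sum_p E j p *: d (X T' p).
have eI j : e j \in @charI G s T'.
  by apply: rpred_sum => p _; apply: ideal_genZ; exact: d_charI.
have [phi phiX] := gen_map T T' (fun j => c j + e j).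
exists phi; split=> [j|j||].
- by rewrite phiX linearD /= eps_c charI_eps ?addr0.
- rewrite phiX /homog /= linearD /= (cP j).1 linear_sum; congr (_ + _).
  apply: eq_bigr => p _; rewrite linearZ /=.
  have [->|jp] := eqVneq (deg j) (deg p - s); last by rewrite Ed ?scale0r.
  by congr (_ *: _); apply: d_homog; exact: homog_gen.
- rewrite (_ : \matrix_j _ = G0 + E *m @dmx G s T') //.
  apply/row_matrixP => j; rewrite linearD /= row_mul !rowK phiX linearD /=.
  congr (_ + _); rewrite linear_sum mulmx_sum_row; apply: eq_bigr => p _ /=.
  by rewrite linearZ rowK mxE.
apply: liftF => j; rewrite phiX raddfD /= (cP j).2.
by have /F'_eq0 -> := eI j; rewrite addr0.
Qed.

Lemma F_charI x : x \in @charI G s T -> F x = 0.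
Proof.
move=> /ideal_genP[l lg ->]; rewrite raddf_sum big_seq big1 // => t /lg[j _ <-].
by rewrite /= !rmorphM /= F_d mulr0 mul0r.
Qed.

Variable n : nat.

Lemma dims_le i :
  [/\ (trunc_dim n (C_ (T := T) i) <= trunc_dim n (C_ (T := T') i))%N,
      (trunc_dim n (J_ (T := T) i) <= trunc_dim n (J_ (T := T') i))%N &
      (trunc_dim n (K_ (T := T) i) <= trunc_dim n (K_ (T := T') i))%N].
Proof.
have [phi [phi_eps phi_h phi_free F_phi]] := exists_lift.
have phi_charI x : x \in @charI G s T -> phi x \in @charI G s T'.
  by move=> /F_charI Fx; apply/F'_eq0; rewrite F_phi.
have phi_inj x : proj (@augpow_gens G s T' n.+1) (phi x) = 0 ->
    proj (@augpow_gens G s T n.+1) x = 0.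
  by move=> /pr_eq0/phi_augpow_inj xP; apply/pr_eq0; exact: xP.
have phi_homogP := phi_homog phi_h.
split; apply: (@lin_dim_image_le _ _ _ _ _ _ _ phi).
- exact: submod_C.
- exact: submod_C.
- exact: fin_spanned_trunc.
- exact: fin_spanned_trunc.
- by move=> x [xP xi]; split; [exact: phi_augpow | exact: phi_homogP].
- by move=> x _; exact: phi_inj.
- exact: submod_J.
- exact: submod_J.
- exact: fin_spanned_trunc.
- exact: fin_spanned_trunc.
- by move=> x [xP xi]; split; [exact: phi_charI | exact: phi_homogP].
- by move=> x _; exact: phi_inj.
- exact: submod_K.
- exact: submod_K.
- exact: fin_spanned_trunc.
- exact: fin_spanned_trunc.
- move=> x [xP xi]; split; last exact: phi_homogP.
  move: xP => /ideal_genP[l lg ->]; rewrite linear_sum big_seq.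
  apply: rpred_sum => t /lg[u uI [v vI <-]] /=; rewrite !rmorphM /=.
  apply: ideal_genMr; apply: ideal_genMl; apply: sub_ideal_gen.
  by exists (phi u); [exact: phi_charI | exists (phi v) => //; exact: phi_charI].
- by move=> x _; exact: phi_inj.
Qed.

End Lift.

(** * Differential algebras with an augmentation, in shifted generators *)

Section Instance.
Variables (r : int) (D : dga r) (e : augmentation D).
Local Notation A := (free_algebra (ngen D)).

Definition shifted_gen (j : 'I_(ngen D)) : A := gen j + (e (gen j))%:A.

Lemma mul_shift (B : lalgType 'F_2) (a x : B) (c : 'F_2) :
  (a + c%:A) * x = a * x + c *: x.
Proof. by rewrite mulrDl -scalerAl mul1r. Qed.

Lemma unshift (B : lalgType 'F_2) (a x : B) (c : 'F_2) :
  a * x = (a + c%:A) * x + c *: x.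
Proof. by rewrite mul_shift -addrA addvv addr0. Qed.

Lemma sgen_ind (P : A -> Prop) : P 0 ->
  (forall x y, P x -> P y -> P (x + y)) -> P 1 ->
  (forall j x, P x -> P (shifted_gen j * x)) -> forall x, P x.
Proof.
move=> P0 PD P1 PX; refine (free_algebra_gen_ind P0 PD P1 _) => j x Px.
rewrite (unshift (gen j) x (e (gen j))); apply: PD; first exact: PX.
by case: (F2_cases (e (gen j))) => ->; rewrite ?scale0r ?scale1r.
Qed.

Lemma sgen_map (B : lalgType 'F_2) (c : 'I_(ngen D) -> B) :
  exists f : {lrmorphism A -> B}, forall j, f (shifted_gen j) = c j.
Proof.
exists (alg_ext (fun j => c j + (e (gen j))%:A)) => j.
rewrite linearD linearZ rmorph1 /= alg_ext_gen -addrA addvv.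
exact: addr0.
Qed.

Lemma e_gen_degree j : e (gen j) != 0 -> gdeg j = 0.
Proof.
move=> ej; apply/eqP; apply: contraNT ej => /aug_degree j0.
by apply/eqP/j0; exact: homogeneous_gen.
Qed.

Lemma comp_sgenM i j x : component_ext (@gdeg r D) i (shifted_gen j * x) =
  shifted_gen j * component_ext (@gdeg r D) (i - gdeg j) x.
Proof.
rewrite /shifted_gen !mul_shift; apply: etrans (linearD _ _ _) _.
apply: (f_equal2 +%R (comp_ext_genM _ _ _ _)); apply: etrans (linearZ _ _) _.
have [->|/e_gen_degree ->] := eqVneq (e (gen j)) 0; first exact: etrans (scale0r _) (esym (scale0r _)).
by rewrite subr0.
Qed.

Lemma fox_sgen1 j : fox_ext (fun a => e (gen a)) j 1 = 0.
Proof. exact: fox_ext1. Qed.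

Lemma fox_sgenM j k x : fox_ext (fun a => e (gen a)) j (shifted_gen k * x) =
  (j == k)%:R *: x.
Proof.
rewrite /shifted_gen mul_shift; apply: etrans (linearD _ _ _) _.
apply: etrans (f_equal2 +%R (fox_ext_genM _ _ _ _) (linearZ _ _)) _.
apply: etrans (esym (addrA _ _ _)) _; apply: etrans (congr1 _ (addvv _)) _.
exact: addr0.
Qed.

Lemma e_sgen j : e (shifted_gen j) = 0.
Proof.
apply: etrans (linearD _ _ _) _; apply: etrans (congr1 _ (linearZ _ _)) _.
rewrite /= rmorph1 mulr1; by case: (F2_cases (e (gen j))) => ->; apply/val_inj.
Qed.

Lemma comp_homogeneous_neq i j x : homogeneous (@gdeg r D) j x -> j != i ->
  component_ext (@gdeg r D) i x = 0.
Proof.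
move=> xj ji; apply/malgP => w; rewrite mcoeff_component_ext mcoeff0.
case: eqP => // wi; apply/mcoeff_outdom/negP => /xj wj.
by rewrite -wj wi eqxx in ji.
Qed.

Lemma comp_diff i x : component_ext (@gdeg r D) (i - degree_of_int r 1) (diff D x) =
  diff D (component_ext (@gdeg r D) i x).
Proof.
elim/free_algebra_ind: x => [|x y IHx IHy|w].
- by rewrite !linear0.
- apply: etrans (congr1 _ (linearD _ _ _)) _; apply: etrans (linearD _ _ _) _.
  apply: etrans (f_equal2 +%R IHx IHy) _; apply: etrans (esym (linearD _ _ _)) _.
  by apply: (congr1 (diff D)); apply: esym; exact: linearD.
have wh : homogeneous (@gdeg r D) (word_degree (@gdeg r D) w) << w >>.
  by move=> v; rewrite msuppU1 inE => /eqP ->.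
have dwh := diff_degree wh.
have [wi|wi] := eqVneq (word_degree (@gdeg r D) w) i.
  rewrite -wi; apply: etrans ((homogeneousP _ _ _).1 dwh) _.
  by apply: (congr1 (diff D)); apply: esym; exact/homogeneousP.
rewrite (comp_homogeneous_neq wh wi) linear0.
by apply: comp_homogeneous_neq dwh _; rewrite (inj_eq (addIr _)).
Qed.

Definition shifted_dga : augmented_dga (degree_of_int r 1) :=
  @AugmentedDGA (degree r) (degree_of_int r 1) (ngen D) A shifted_gen (@gdeg r D)
    (fun i => component_ext (@gdeg r D) i) (fun j => fox_ext (fun a => e (gen a)) j)
    e (diff D) sgen_ind sgen_map (comp_ext1 (@gdeg r D)) comp_sgenM
    fox_sgen1 fox_sgenM e_sgen (@diff_Leibniz r D) (@diff_diff r D)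
    (@aug_diff r D e) comp_diff.

Lemma diff_sgen j : diff D (shifted_gen j) = diff D (gen j).
Proof.
apply: etrans (linearD _ _ _) _; rewrite diff_const; exact: addr0.
Qed.

Lemma charI_gens : [set diff D (gen j) | j in [set: 'I_(ngen D)]] =
  [set d (X shifted_dga j) | j in [set: 'I_(ngen D)]].
Proof. by apply: eq_imagel => j _; rewrite -diff_sgen. Qed.

Lemma trunc_pieceE n i : @trunc_piece r D e n i =
  proj (@augpow_gens _ _ shifted_dga n.+1) @` @C_ _ _ shifted_dga i.
Proof.
apply/seteqP; split=> q [x [ex xi] <-]; exists x => //; split.
- exact: (@augpow1 _ _ shifted_dga x).2 ex.
- exact/homogeneousP.
- exact: (@augpow1 _ _ shifted_dga x).1 ex.
- exact/homogeneousP.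
Qed.

Lemma alphaE n i : @alpha r D e n i = lin_dim (@cycles _ _ shifted_dga n i).
Proof. by rewrite /alpha trunc_pieceE. Qed.

Lemma betaE n i : @beta r D e n i = lin_dim (@boundaries _ _ shifted_dga n i).
Proof. by rewrite /beta trunc_pieceE. Qed.

End Instance.

(** * Comparison of the polynomials *)

Section Presentations.
Variables (r : int) (B : pzRingType).

Definition char_ideal (D : dga r) : {pred free_algebra (ngen D)} :=
  ideal_gen [set diff D (gen j) | j in [set: 'I_(ngen D)]].
Arguments char_ideal : clear implicits.

(** Proved for an algebra without augmentation, as it serves to construct one. *)
Lemma char_ideal_diff (D : dga r) (x : free_algebra (ngen D)) :
  diff D x \in char_ideal D.
Proof.
elim/free_algebra_gen_ind: x => [|x y IHx IHy||a x IHx].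
- rewrite linear0; exact: ideal_gen0.
- have -> : diff D (x + y) = diff D x + diff D y by exact: linearD.
  exact: ideal_genD.
- rewrite -[X in diff D X](scale1r (1 : free_algebra (ngen D))) diff_const.
  exact: ideal_gen0.
rewrite diff_Leibniz; apply: ideal_genD; last exact: ideal_genMl.
by apply: ideal_genMr; apply: sub_ideal_gen; exists a.
Qed.

Lemma aug_char_ideal (D : dga r) (e : augmentation D) x :
  x \in char_ideal D -> e x = 0.
Proof.
move=> /ideal_genP[l lg ->]; apply: etrans (linear_sum _ _ _ _) _.
rewrite big_seq; apply: big1 => t /lg[j _ <-].
apply: etrans (rmorphM _ _ _) _.
apply: etrans (congr1 (fun c => c * _) (rmorphM _ _ _)) _.
by rewrite /= aug_diff mulr0 mul0r.
Qed.

(** F and F' identify the characteristic algebras of D and D', as graded algebras,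
    with the same ring B.  In contrast with an isomorphism between quotients, this
    relation is visibly symmetric. *)
Record same_char_algebra_in (D D' : dga r)
    (F : {rmorphism free_algebra (ngen D) -> B})
    (F' : {rmorphism free_algebra (ngen D') -> B}) : Prop := SameCharAlgebra {
  ker_l : forall x, F x = 0 <-> x \in char_ideal D;
  ker_r : forall y, F' y = 0 <-> y \in char_ideal D';
  lift_l : forall x, exists y, F' y = F x;
  lift_r : forall y, exists x, F x = F' y;
  lift_homogeneous_l : forall i x, homogeneous (@gdeg r D) i x ->
    exists2 y, homogeneous (@gdeg r D') i y & F' y = F x;
  lift_homogeneous_r : forall i y, homogeneous (@gdeg r D') i y ->
    exists2 x, homogeneous (@gdeg r D) i x & F x = F' y
}.

Lemma same_char_algebra_sym D D' F F' :
  @same_char_algebra_in D D' F F' -> same_char_algebra_in F' F.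
Proof. by case=> *; split. Qed.

Section Transport.
Variables (D D' : dga r).
Variables (F : {rmorphism free_algebra (ngen D) -> B})
  (F' : {rmorphism free_algebra (ngen D') -> B}).
Hypothesis FF' : same_char_algebra_in F F'.

(** An augmentation of D factors through B, hence induces one of D'.  It respects
    the grading because homogeneous elements of D' have homogeneous counterparts
    in D. *)
Lemma transport_augmentation (e : augmentation D) :
  exists e' : augmentation D', forall x y, F x = F' y -> e x = e' y.
Proof.
have /choice[g gP] := lift_r FF'.
have eF x y : F x = F y -> e x = e y.
  move=> xy; apply: subr0_eq; apply: etrans (esym (linearB _ _ _)) _.
  apply: aug_char_ideal; apply/(ker_l FF').
  by rewrite raddfB /= xy subrr.
pose e' y := e (g y).
have e'F x y : F x = F' y -> e x = e' y by move=> xy; apply: eF; rewrite gP.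
have e'B : zmod_morphism e'.
  move=> x y; rewrite /e' -[RHS](linearB e); apply: eF.
  by rewrite gP !raddfB /= !gP.
have e'Z : scalable_for *%R e'.
  move=> c y; case: (F2_cases c) => ->; last by rewrite scale1r mul1r.
  rewrite scale0r mul0r; apply: etrans (esym (e'F 0 0 _)) (linear0 e).
  by rewrite !raddf0.
have e'M : monoid_morphism e'.
  split=> [|x y].
    by apply: etrans (esym (e'F 1 1 _)) (rmorph1 e); rewrite !rmorph1.
  rewrite /e' -[RHS](rmorphM e); apply: eF.
  by rewrite gP !rmorphM /= !gP.
pose e'0 := GRing.isZmodMorphism.Build _ _ e' e'B.
pose e'1 := GRing.isScalable.Build _ _ _ _ e' e'Z.
pose e'2 := GRing.isMonoidMorphism.Build _ _ e' e'M.
pose m : {lrmorphism free_algebra (ngen D') -> 'F_2 | *%R} :=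
  HB.pack e' e'0 e'1 e'2.
have md y : m (diff D' y) = 0.
  apply: etrans (esym (e'F 0 _ _)) (linear0 e); rewrite raddf0.
  by apply/esym/(ker_r FF'); exact: char_ideal_diff.
have mdeg i y : i != 0 -> homogeneous (@gdeg r D') i y -> m y = 0.
  move=> i0 /(lift_homogeneous_r FF')[x xi Fx].
  by rewrite -(aug_degree e i0 xi); apply: esym; exact: e'F.
by exists (Augmentation md mdeg).
Qed.

Hypothesis same_degrees :
  forall i : degree r, degree_distribution D i = degree_distribution D' i.
Variables (e : augmentation D) (e' : augmentation D').
Hypothesis ee' : forall x y, F x = F' y -> e x = e' y.

Lemma char_ideal_charI (E : dga r) (u : augmentation E) x :
  x \in char_ideal E <-> x \in @charI _ _ (shifted_dga u).
Proof. by rewrite /charI /char_ideal (charI_gens u). Qed.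

Lemma transported_dims_le n i :
  [/\ (trunc_dim n (C_ (T := shifted_dga e) i) <=
       trunc_dim n (C_ (T := shifted_dga e') i))%N,
      (trunc_dim n (J_ (T := shifted_dga e) i) <=
       trunc_dim n (J_ (T := shifted_dga e') i))%N &
      (trunc_dim n (K_ (T := shifted_dga e) i) <=
       trunc_dim n (K_ (T := shifted_dga e') i))%N].
Proof.
apply: (@dims_le _ _ (shifted_dga e) (shifted_dga e') B F F').
- exact: same_degrees.
- move=> j; apply/(ker_l FF'); exact: char_ideal_diff.
- by move=> y; rewrite -char_ideal_charI; exact: ker_r FF' y.
- move=> k x /homogeneousP xk; have [y yk Fy] := lift_homogeneous_l FF' xk.
  by exists y => //; exact/homogeneousP.
- exact: lift_r FF'.
- exact: ee'.
Qed.

End Transport.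
End Presentations.
Arguments char_ideal {r} D.

Section Comparison.
Variables (r : int) (B : pzRingType) (D D' : dga r).
Variables (F : {rmorphism free_algebra (ngen D) -> B})
  (F' : {rmorphism free_algebra (ngen D') -> B}).
Hypothesis FF' : same_char_algebra_in F F'.
Hypothesis same_degrees :
  forall i : degree r, degree_distribution D i = degree_distribution D' i.

Lemma poincare_chekanov_eq (n : nat) (e : augmentation D) (e' : augmentation D') :
  n = 1%N \/ n = 2%N -> (forall x y, F x = F' y -> e x = e' y) ->
  poincare_chekanov e n = poincare_chekanov e' n.
Proof.
move=> n12 ee'; have e'e y x : F' y = F x -> e' y = e x.
  by move=> /esym/ee'.
have le := transported_dims_le FF' same_degrees ee' n.
have ge := transported_dims_le (same_char_algebra_sym FF')
  (fun i => esym (same_degrees i)) e'e n.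
have eqC i := dim_C (shifted_dga e) n i.
have eqC' i := dim_C (shifted_dga e') n i.
have eqJ i := @dim_J _ _ (shifted_dga e) n n12 i.
have eqJ' i := @dim_J _ _ (shifted_dga e') n n12 i.
have dimC i : trunc_dim n (C_ (T := shifted_dga e) i) =
    trunc_dim n (C_ (T := shifted_dga e') i).
  by have [l _ _] := le i; have [g _ _] := ge i; apply/eqP; rewrite eqn_leq l g.
have dimJ i : trunc_dim n (J_ (T := shifted_dga e) i) =
    trunc_dim n (J_ (T := shifted_dga e') i).
  by have [_ l _] := le i; have [_ g _] := ge i; apply/eqP; rewrite eqn_leq l g.
have dimK i : trunc_dim n (K_ (T := shifted_dga e) i) =
    trunc_dim n (K_ (T := shifted_dga e') i).
  by have [_ _ l] := le i; have [_ _ g] := ge i; apply/eqP; rewrite eqn_leq l g.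
have beta_eq i : @beta r D e n i = @beta r D' e' n i.
  rewrite !betaE; have := dimJ i; rewrite eqJ eqJ' dimK.
  exact: addIn.
have alpha_eq i : @alpha r D e n i = @alpha r D' e' n i.
  rewrite !alphaE; have := dimC i; rewrite eqC eqC' -!betaE beta_eq.
  exact: addIn.
by apply: eq_fsbigr => i _; rewrite alpha_eq beta_eq.
Qed.

Lemma poincare_chekanov_sub (n : nat) : n = 1%N \/ n = 2%N ->
  [set @poincare_chekanov r D e n | e in [set: augmentation D]] `<=`
  [set @poincare_chekanov r D' e n | e in [set: augmentation D']].
Proof.
move=> n12 _ [e _ <-]; have [e' ee'] := transport_augmentation FF' e.
refine (ex_intro2 _ _ e' I _); exact: esym (poincare_chekanov_eq n12 ee').
Qed.

End Comparison.

Theorem proposition3p8 (r : int) (D D' : dga r)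
  (same_degrees : forall i : degree r,
     degree_distribution D i = degree_distribution D' i)
  (same_char_algebra : graded_algebra_isomorphic D D')
  (n : nat) (n12 : n = 1%N \/ n = 2%N) :
  [set @poincare_chekanov r D eps n | eps in [set: augmentation D]] =
  [set @poincare_chekanov r D' eps n | eps in [set: augmentation D']].
Proof.
have [f [_ f_bij f_piece]] := same_char_algebra.
pose p : {rmorphism free_algebra (ngen D) -> char_algebra D} := proj _.
pose p' : {rmorphism free_algebra (ngen D') -> char_algebra D'} := proj _.
have p_eq0 (E : dga r) (x : free_algebra (ngen E)) :
    proj _ x = 0 :> char_algebra E <-> x \in char_ideal E.
  rewrite -(raddf0 (proj _)); split=> [/eqP|xI]; last apply/eqP.
    by rewrite proj_eq subr0.
  by rewrite proj_eq subr0.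
have FF' : @same_char_algebra_in r _ D D' (f \o p) p'.
  split=> [x|y|x|y|i x xi|i y yi] /=.
  - rewrite -p_eq0; split=> [fx|->]; last by rewrite raddf0.
    by apply: (bij_inj f_bij); rewrite raddf0.
  - exact: p_eq0.
  - by exists (repr (f (p x))); exact: proj_repr.
  - have [g _ gK] := f_bij; exists (repr (g (p' y))).
    by rewrite /p proj_repr gK.
  - have : (@char_piece r D' i) (f (p x)).
      by rewrite -f_piece; exists (p x) => //; exists x.
    by move=> [y yi yx]; exists y.
  have : (f @` @char_piece r D i) (p' y) by rewrite f_piece; exists y.
  by move=> [_ [x xi <-] fx]; exists x.
apply/seteqP; split; first exact: (poincare_chekanov_sub FF' same_degrees n12).
exact: (poincare_chekanov_sub (same_char_algebra_sym FF')
  (fun i => esym (same_degrees i)) n12).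
Qed.
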